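(* There exists an absolute constant $\beta_*>0$ with the following property. Let $\eta\ge2$ be an integer, let $\varphi$ be an adaptive function, let $\mathtt d,\tilde\Delta_\infty$ be approximation functions, let $\gamma>0$, let $f\in\mathcal B_{\tilde\Delta_\infty}$, and let $\rho\in\mathbb T^\infty$ satisfy the infinite-dimensional nonresonant condition with data $(\gamma,\mathtt d)$ (in the discrete sense (c) for the first estimate, in the continuous sense (d) for the second estimate). Assume that for some $c>0$ $$\sum_{0\ne k\in\mathbb Z_*^\infty,\ |k|_\eta>\mathtt d^{-1}(2\pi\gamma x/\varphi(x))}\frac{\mathtt d^2(|k|_\eta)}{\tilde\Delta_\infty(|k|_\eta)}=\mathcal O(e^{-cx}),\qquad x\to+\infty .$$ Then there is a constant $C_6>0$, depending only on $f,\mathtt d,\tilde\Delta_\infty,\eta,\gamma,\varphi,c$, such that for all sufficiently large $N$ (integer) and $T$ (real) and all $\theta\in\mathbb T^\infty$: (discrete case) if $\rho$ satisfies (c), then $$\left\|\overline{\mathrm{WB}}_N(f)(\theta)-\int_{\mathbb T^\infty}f(\hat\theta)\,d\hat\theta\right\|_{\mathcal B}\le C_6\exp\left(-(\varphi(N))^{\beta_*}\right);$$ (continuous case) if $\rho$ satisfies (d), then $$\left\|\frac1T\int_0^T\bar w(t/T)\,f(\rho t+\theta)\,dt-\int_{\mathbb T^\infty}f(\hat\theta)\,d\hat\theta\right\|_{\mathcal B}\le C_6\exp\left(-(\varphi(T))^{\beta_*}\right).$$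
   Context: An approximation function is a continuous, strictly increasing function $\Delta:[1,+\infty)\to[1,+\infty)$ with $\Delta(+\infty)=+\infty$; $\mathtt d^{-1}$ denotes the inverse function of $\mathtt d$ and $\mathtt d^2(x)=(\mathtt d(x))^2$. An adaptive function is a nondecreasing function $\varphi$ on $[1,+\infty)$ with $\varphi(+\infty)=+\infty$ and $\varphi(x)=o(x)$ as $x\to+\infty$. $\mathbb N=\{0,1,2,\dots\}$, $\mathbb T^\infty=\mathbb T^{\mathbb N}$ with the product (normalized Lebesgue) probability measure; the set of rotation vectors $\rho$ is identified with the cube $[1,2]^{\mathbb N}$. For a fixed integer $\eta\ge2$, $$\mathbb Z_*^\infty=\Big\{k\in\mathbb Z^{\mathbb N}:\ |k|_\eta:=\sum_{j\in\mathbb N}\langle j\rangle^\eta|k_j|<+\infty\Big\},\qquad \langle j\rangle=\max\{1,|j|\},$$ so each such $k$ has finite support. The irrational vector $\rho\in\mathbb T^\infty$ satisfies the infinite-dimensional nonresonant condition with data $\gamma>0$ and approximation function $\mathtt d$ if (c) (discrete case) $|k\cdot\rho-n|>\gamma/\mathtt d(|k|_\eta)$ for all $0\ne k\in\mathbb Z_*^\infty$ and all $n\in\mathbb Z$; (d) (continuous case) $|k\cdot\rho|>\gamma/\mathtt d(|k|_\eta)$ for all $0\ne k\in\mathbb Z_*^\infty$. $(\mathcal B,\|\cdot\|_{\mathcal B})$ is a Banach (function) space, possibly infinite-dimensional, over complex scalars. For an approximation function $\tilde\Delta_\infty$, $\mathcal B_{\tilde\Delta_\infty}$ is the set of $f:\mathbb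 T^\infty\to\mathcal B$ such that $f(\theta)=\sum_{k\in\mathbb Z_*^\infty}\hat f_k e^{2\pi i k\cdot\theta}$ for every $\theta$ (equality in the norm of $\mathcal B$), where $\hat f_k=\int_{\mathbb T^\infty}f(\hat\theta)e^{-2\pi i k\cdot\hat\theta}\,d\hat\theta$, and $\sup_{0\ne k\in\mathbb Z_*^\infty}\tilde\Delta_\infty(|k|_\eta)\,\|\hat f_k\|_{\mathcal B}<+\infty$. The weighting function is $$\bar w(x)=\left(\int_0^1\exp\left(-s^{-1}(1-s)^{-1}\right)ds\right)^{-1}\exp\left(-x^{-1}(1-x)^{-1}\right)\ \text{ on }(0,1),\qquad \bar w(0)=\bar w(1)=0.$$ With $T_\rho(\theta)=\theta+\rho \bmod 1$ in each coordinate, $$\overline{\mathrm{WB}}_N(f)(\theta)=\frac1{A_N}\sum_{n=0}^{N-1}\bar w\!\left(\frac nN\right)f(T_\rho^n(\theta)),\qquad A_N=\sum_{n=0}^{N-1}\bar w\!\left(\frac nN\right).$$ *)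

(* Defs.v *)
From HB Require Import structures.
From mathcomp Require Import all_boot all_order all_algebra.
From mathcomp Require Import finmap complex.
From mathcomp Require Import all_classical all_reals all_analysis.

Set Implicit Arguments.
Unset Strict Implicit.
Unset Printing Implicit Defensive.

Import Order.TTheory GRing.Theory Num.Theory.
Import numFieldNormedType.Exports.

Local Open Scope classical_set_scope.
Local Open Scope ring_scope.
Local Open Scope complex_scope.

(* The norm of a normed space over R[i] takes its values in R[i]. They are
   nonnegative reals, so taking the real part loses nothing. *)
Definition rnorm (R : realType) (B : normedModType R[i]) (v : B) : R :=
  complex.Re `|v|.

Definition cis (R : realType) (t : R) : R[i] := cos t +i* sin t.

Section Bochner.
Context (d : measure_display) (X : measurableType d) (R : realType).
Context (mu : {measure set X -> \bar R}) (D : set X).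
Context (B : completeNormedModType R[i]).
Local Open Scope ereal_scope.

Definition is_simple (s : X -> B) : Prop :=
  finite_set (s @` D) /\
  forall b : B, measurable (D `&` s @^-1` [set b]) /\
    (b != 0%R -> mu (D `&` s @^-1` [set b]) < +oo).

Definition simple_integral (s : X -> B) : B :=
  (\sum_(b \in s @` D) (fine (mu (D `&` s @^-1` [set b])))%:C *: b)%R.

(* f is, almost everywhere on D, a limit of simple functions that also converge
   to f in the L^1 sense; its integral is the limit of their integrals. *)
Definition is_bochner_integral (f : X -> B) (v : B) : Prop :=
  exists s : nat -> X -> B,
    [/\ forall n, is_simple (s n),
        {ae mu, forall x, D x -> s n x @[n --> \oo] --> f x},
        \int[mu]_(x in D) (rnorm (f x - s n x))%:E @[n --> \oo] --> 0 &
        simple_integral (s n) @[n --> \oo] --> v].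

Definition bochner_integrable (f : X -> B) : Prop :=
  exists v, is_bochner_integral f v.

Definition bochner_integral (f : X -> B) : B :=
  xget 0%R [set v | is_bochner_integral f v].

End Bochner.

(* The circle R/Z, represented by the fundamental domain [0, 1[. *)
Definition circle (R : realType) : Type := {x : R | 0 <= x < 1}.

Fact mod1_subproof (R : realType) (x : R) : 0 <= x - (Num.floor x)%:~R < 1.
Proof.
by rewrite subr_ge0 floor_le ltrBlDl -intrD1 floorD1_gt.
Qed.

Definition mod1 (R : realType) (x : R) : circle R :=
  exist _ (x - (Num.floor x)%:~R) (mod1_subproof x).

HB.instance Definition _ (R : realType) := Choice.on (circle R).
HB.instance Definition _ (R : realType) :=
  isPointed.Build (circle R) (mod1 (0 : R)).

Definition cylinders (R : realType) : set (set (nat -> circle R)) :=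
  [set C | exists (j : nat) (A : set R),
     measurable A /\ C = [set theta | A (sval (theta j))]].

Definition torus (R : realType) := g_sigma_algebraType (@cylinders R).

(* This determines mu, since the finite-dimensional boxes form a pi-system
   generating the sigma-algebra. *)
Definition is_product_lebesgue (R : realType)
    (mu : probability (torus R) R) : Prop :=
  forall (n : nat) (A : nat -> set R), (forall j, measurable (A j)) ->
    mu [set theta : torus R | forall j, (j < n)%N -> A j (sval (theta j))] =
    (\prod_(j < n) lebesgue_measure (A j `&` `[0%R, 1%R[%classic))%E.

Definition translate (R : realType) (v : nat -> R) (theta : torus R) :
  torus R := fun j => mod1 (sval (theta j) + v j).

(* |k|_eta = \sum_j <j>^eta |k_j|, possibly +oo; here j >= 0, so that
   <j> = max(1, j). *)
Definition eta_enorm (R : realType) (eta : nat) (k : nat -> int) : \bar R :=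
  (\sum_(0 <= j <oo) ((maxn 1 j ^ eta * `|k j|)%N%:R)%:E)%E.

Definition eta_norm (R : realType) (eta : nat) (k : nat -> int) : R :=
  fine (eta_enorm R eta k).

Definition Zstar (R : realType) (eta : nat) : set (nat -> int) :=
  [set k | (eta_enorm R eta k < +oo)%E].

(* A finitely supported sum: every k in Zstar has finite support (the sum
   would be 0 for a k of infinite support). *)
Definition dot (R : realType) (k : nat -> int) (x : nat -> R) : R :=
  \sum_(j \in [set: nat]) (k j)%:~R * x j.

Definition tdot (R : realType) (k : nat -> int) (theta : torus R) : R :=
  dot k (fun j => sval (theta j)).

(* Only the values on [1, +oo[ matter. *)
Definition approximation_function (R : realType) (D : R -> R) : Prop :=
  [/\ {within `[1, +oo[, continuous D},
      {in `[1, +oo[ &, {homo D : x y / x < y}},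
      (forall x, 1 <= x -> 1 <= D x) &
      D x @[x --> +oo] --> +oo].

(* The inverse of D on D([1, +oo[) = [D 1, +oo[; it is 1 elsewhere. *)
Definition approx_inv (R : realType) (D : R -> R) : R -> R :=
  'pinv_(fun=> 1) `[1, +oo[ D.

Definition adaptive_function (R : realType) (phi : R -> R) : Prop :=
  [/\ {in `[1, +oo[ &, {homo phi : x y / x <= y}},
      phi x @[x --> +oo] --> +oo &
      phi x / x @[x --> +oo] --> (0 : R)].

Definition nonresonant_discrete (R : realType) (eta : nat) (gamma : R)
    (d : R -> R) (rho : nat -> R) : Prop :=
  forall k, Zstar R eta k -> k != 0 -> forall n : int,
    gamma / d (eta_norm R eta k) < `|dot k rho - n%:~R|.

Definition nonresonant_continuous (R : realType) (eta : nat) (gamma : R)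
    (d : R -> R) (rho : nat -> R) : Prop :=
  forall k, Zstar R eta k -> k != 0 ->
    gamma / d (eta_norm R eta k) < `|dot k rho|.

Section FunctionSpace.
Context (R : realType) (B : completeNormedModType R[i]).
Context (mu : probability (torus R) R).

Definition fourier_integrand (f : torus R -> B) (k : nat -> int) :
  torus R -> B := fun theta => cis (- (2 * pi * tdot k theta)) *: f theta.

Definition fourier_coef (f : torus R -> B) (k : nat -> int) : B :=
  bochner_integral mu setT (fourier_integrand f k).

(* Convergence along the net of finite subsets of A. *)
Definition has_sum (I : choiceType) (A : set I) (u : I -> B) (v : B) : Prop :=
  forall e : R, 0 < e -> exists F0 : {fset I}, [set` F0] `<=` A /\
    forall F : {fset I}, [set` F0] `<=` [set` F] -> [set` F] `<=` A ->
      rnorm (\sum_(i <- F) u i - v) < e.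

Definition in_BDelta (eta : nat) (Delta : R -> R) (f : torus R -> B) : Prop :=
  [/\ forall k, Zstar R eta k ->
        bochner_integrable mu setT (fourier_integrand f k),
      forall theta, has_sum (Zstar R eta)
        (fun k => cis (2 * pi * tdot k theta) *: fourier_coef f k) (f theta) &
      exists M : R, forall k, Zstar R eta k -> k != 0 ->
        Delta (eta_norm R eta k) * rnorm (fourier_coef f k) <= M].

End FunctionSpace.

Definition wbar (R : realType) (x : R) : R :=
  if 0 < x < 1 then
    (\int[@lebesgue_measure R]_(s in `]0, 1[) expR (- (s^-1 * (1 - s)^-1)))^-1
      * expR (- (x^-1 * (1 - x)^-1))
  else 0.

Definition WB_discrete (R : realType) (B : completeNormedModType R[i])
    (rho : nat -> R) (f : torus R -> B) (N : nat) (theta : torus R) : B :=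
  ((\sum_(0 <= n < N) wbar (n%:R / N%:R : R))^-1)%:C *:
    \sum_(0 <= n < N)
      (wbar (n%:R / N%:R : R))%:C *: f (iter n (translate rho) theta).

Definition WB_continuous (R : realType) (B : completeNormedModType R[i])
    (rho : nat -> R) (f : torus R -> B) (T : R) (theta : torus R) : B :=
  (T^-1)%:C *:
    bochner_integral (@lebesgue_measure R) `[0, T]
      (fun t => (wbar (t / T))%:C *: f (translate (fun j => rho j * t) theta)).

Definition truncation_condition (R : realType) (eta : nat)
    (phi d Delta : R -> R) (gamma c : R) : Prop :=
  exists M : R, \forall x \near +oo,
    (\esum_(k in [set k : nat -> int | [/\ Zstar R eta k, k != 0%R &
         (approx_inv d (2 * pi * gamma * x / phi x) < eta_norm R eta k)%R]])
       (d (eta_norm R eta k) ^+ 2 / Delta (eta_norm R eta k))%:E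
     <= (M * expR (- (c * x)))%:E)%E.

(* Main.v *)
Require Import Defs.
From HB Require Import structures.
From mathcomp Require Import all_boot all_order all_algebra.
From mathcomp Require Import finmap complex.
From mathcomp Require Import all_classical all_reals all_analysis.
From mathcomp Require Import measurable_realfun ring lra zify.

Import Order.TTheory GRing.Theory Num.Theory.
Import numFieldNormedType.Exports.
Import ComplexField.Normc.

Local Open Scope classical_set_scope.
Local Open Scope ring_scope.
Local Open Scope complex_scope.

(** Expand [f] in its Fourier series. Averaging acts on the mode of frequency [k] as
    multiplication by the weighted exponential sum
    [A_N^-1 * \sum_(n < N) w (n / N) e^(2 i pi n (k . rho))], so the error is at most the
    sum over [k != 0] of the norm of the coefficient times the modulus of this multiplier.
    Frequencies are cut at [cutoff x], where [x] is the averaging time.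

    Above the cutoff the multipliers are at most [1] and the coefficients sum to
    [O(e^(- c x))] by the truncation hypothesis, because [d >= 1]
    ([fourier_coef_tail]). Below the cutoff the nonresonance condition keeps [k . rho] at
    distance at least [phi x / (2 pi x)] from the integers, or from zero for the flow
    ([low_frequency]), and [m]
    summations by parts bound the multiplier by [(C m^3 / phi x)^m] up to a constant
    ([bump_expsum_le]), since the [m]-th finite differences of the bump function with step
    [1 / N] are at most [(20 m^3 / N)^m] ([iter_bdiff_bump_le]). With [m] of order
    [(phi x)^(1/4)] this is at most [exp (- (phi x)^(1/4))] ([parts_number_bound]), which also
    dominates [e^(- c x)] as [phi] is sublinear. The coefficients are absolutely summable,
    since only finitely many frequencies lie below a given cutoff
    ([fourier_coef_summable]), so adding up the low frequencies costs only a constant.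

    The flow is reduced to the rotation. Along an orbit the weighted observable is a uniform
    limit of trigonometric polynomials, hence uniformly continuous
    ([weighted_flow_uniform]), and its Bochner integral is the limit of its Riemann sums
    ([cvg_riemann_sum]). The Riemann sum with [n] points over the time [T] is a weighted
    average for the rotation vector [(T / n) rho]; for the finitely many frequencies below
    the cutoff and [n] large, [(T / n) (k . rho)] is at most [1/2] in modulus, so that its
    distance to the integers is its modulus. The estimate for rotations,
    [weighted_average_le], is uniform in [n]. *)

Set Implicit Arguments.
Unset Strict Implicit.
Unset Printing Implicit Defensive.

(** * A bump function and its finite differences *)

Section Bump.
Variable R : realType.
Implicit Types (x h : R) (a b m M n : nat).

Lemma expr_expRN_le n x : 0 <= x -> x ^+ n * expR (- x) <= n`!%:R.
Proof.
move=> x0; case: n => [|n]; first by rewrite expr0 mul1r fact0 expR_le1 oppr_le0.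
rewrite expRN ler_pdivrMr ?expR_gt0 // mulrC -ler_pdivrMr ?ltr0n ?fact_gt0 //.
by apply: le_trans (expR_ge1Dxn n x0); rewrite lerDr.
Qed.

Definition bump_exponent x : R := x^-1 * (1 - x)^-1.

(** A family that contains the bump function [exp (- u)], [u = 1 / (x (1 - x))], and whose
    span is stable under differentiation, because [u' = (2 x - 1) u^2]. *)
Definition bump_mono a b x : R :=
  if 0 < x < 1 then
    (2 * x - 1) ^+ a * bump_exponent x ^+ b * expR (- bump_exponent x)
  else 0.

Lemma bump_exponent_gt0 x : 0 < x < 1 -> 0 < bump_exponent x.
Proof.
by case/andP=> x0 x1; rewrite mulr_gt0 ?invr_gt0 ?subr_gt0.
Qed.

Lemma bump_mono_le a b x : `|bump_mono a b x| <= b`!%:R.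
Proof.
rewrite /bump_mono; case: ifPn => [x01|_]; last by rewrite normr0.
have u0 := bump_exponent_gt0 x01.
rewrite -mulrA normrM normrX [X in _ * X]ger0_norm; last by rewrite mulr_ge0 ?exprn_ge0 ?expR_ge0 ?ltW.
apply: le_trans (expr_expRN_le b (ltW u0)).
apply: ler_piMl; first by rewrite mulr_ge0 ?exprn_ge0 ?expR_ge0 ?ltW.
by rewrite exprn_ile1 // ler_norml; case/andP: x01; lra.
Qed.

(** The bump functions vanish to second order at every point outside ]0, 1[,
    endpoints included: this is where the factor exp(-u) is needed. *)
Lemma bump_mono_quad a b x0 x : ~~ (0 < x0 < 1) ->
  `|bump_mono a b x| <= (b + 2)`!%:R * (x - x0) ^+ 2.
Proof.
move=> nx0; rewrite {1}/bump_mono; case: ifPn => [x01|_]; last first.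
  by rewrite normr0 mulr_ge0 ?sqr_ge0 ?ler0n.
have u0 := bump_exponent_gt0 x01.
have := bump_mono_le a (b + 2) x.
rewrite {1}/bump_mono x01 exprD.
set t := expR _; set s := _ ^+ a; set v := _ ^+ b; set u := bump_exponent x => H.
have -> : s * v * t = s * (v * u ^+ 2) * t * (u ^+ 2)^-1.
  by field; rewrite gt_eqF.
rewrite normrM; apply: ler_pM => //.
have -> : (u ^+ 2)^-1 = (x * (1 - x)) ^+ 2.
  by rewrite /u /bump_exponent -invfM exprVn invrK.
rewrite ger0_norm ?sqr_ge0 // -[leRHS]real_normK ?num_real //.
have /andP[x0' x1'] := x01.
apply: lerXn2r; rewrite ?nnegrE ?normr_ge0 ?mulr_ge0 ?subr_ge0 ?(ltW x0') ?(ltW x1') //.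
move: nx0; rewrite negb_and -!leNgt => /orP[x00|x01'].
  by rewrite ger0_norm; nra.
by rewrite ler0_norm; nra.
Qed.

Lemma is_derive0_of_quad (f : R -> R) (x0 C : R) : f x0 = 0 ->
  (forall x, `|f x| <= C * (x - x0) ^+ 2) -> is_derive x0 1 f 0.
Proof.
move=> f0 fC.
suff H : (h^-1 *: ((f \o shift x0) (h *: 1) - f x0)) @[h --> 0^'] --> (0 : R).
  by apply: DeriveDef; [apply: (cvgP 0) | apply: cvg_lim].
apply/cvgrPdist_le => e e0.
have C0 : 0 <= C.
  have := le_trans (normr_ge0 _) (fC (x0 + 1)).
  by rewrite (_ : x0 + 1 - x0 = 1) ?expr1n ?mulr1 //; ring.
near=> h.
have h0 : h != 0 by near: h; exact: nbhs_dnbhs_neq.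
rewrite sub0r normrN f0 subr0 /= [_ *: _]/(_ * _) normrM normfV.
rewrite ler_pdivrMl ?normr_gt0 //.
apply: le_trans (fC _) _; rewrite addrK /GRing.scale /= mulr1.
rewrite -[_ ^+ 2]real_normK ?num_real // expr2 mulrCA ler_wpM2l //.
have : `|h| <= e / (C + 1).
  near: h; apply: dnbhs0_le; rewrite divr_gt0 //; lra.
by rewrite ler_pdivlMr; [nra | lra].
Unshelve. all: by end_near.
Qed.

(** Differentiation maps the span of the [bump_mono] to itself, with explicit
    integer coefficients: this yields the Gevrey bound on all derivatives
    without any formula for them. *)
Lemma is_derive_bump_mono a b x : is_derive x 1 (bump_mono a b)
  (2 * a%:R * bump_mono a.-1 b x + b%:R * bump_mono a.+1 b.+1 x
   - bump_mono a.+1 b.+2 x).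
Proof.
have [x01|x01] := boolP (0 < x < 1); last first.
  have bump0 a' b' : bump_mono a' b' x = 0 by rewrite /bump_mono (negbTE x01).
  rewrite !bump0 !mulr0 addr0 subr0.
  apply: (@is_derive0_of_quad _ _ (b + 2)`!%:R) => // y.
  exact: bump_mono_quad.
have /andP[x0 x1] := x01.
have bumpE a' b' : bump_mono a' b' x = (2 * x - 1) ^+ a' * bump_exponent x ^+ b' *
    expR (- bump_exponent x) by rewrite /bump_mono x01.
rewrite !bumpE.
have du : is_derive x 1 bump_exponent ((2 * x - 1) * bump_exponent x ^+ 2).
  have d1 : is_derive x 1 (fun y : R => (1 - y)) (-1).
    apply: is_derive_eq (is_deriveB (is_derive_cst _ _ _) (is_derive_id _ _)) _.
    by rewrite sub0r.
  have d2 : is_derive x 1 (fun y : R => y^-1) (- x ^- 2 *: 1).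
    by apply: is_deriveV; rewrite gt_eqF.
  have d3 : is_derive x 1 (fun y : R => (1 - y)^-1) (- (1 - x) ^- 2 *: -1).
    by apply: is_deriveV; rewrite gt_eqF // subr_gt0.
  apply: is_derive_eq (is_deriveM d2 d3) _.
  rewrite /bump_exponent /GRing.scale /=; field.
  by rewrite ?subr_eq0 ?gt_eqF ?(gt_eqF x1) // subr_gt0.
have ds : is_derive x 1 (fun y : R => 2 * y - 1) 2.
  apply: is_derive_eq (is_deriveB (is_deriveZ 2 (is_derive_id _ _)) (is_derive_cst _ _ _)) _.
  by rewrite subr0 /GRing.scale /= mulr1.
have de : is_derive x 1 (expR \o (- bump_exponent))
    (expR (- bump_exponent x) * (- ((2 * x - 1) * bump_exponent x ^+ 2))).
  exact: (is_derive1_comp (is_derive_expR _) (is_deriveN du)).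
have dF := is_deriveM (is_deriveM (is_deriveX a ds) (is_deriveX b du)) de.
apply: near_eq_is_derive (is_derive_eq dF _).
  near=> y.
  have y01 : 0 < y < 1.
    by apply/andP; split; near: y; [exact: lt_nbhsr | exact: lt_nbhsl].
  by rewrite /bump_mono y01 !fctE.
rewrite !fctE /GRing.scale /=.
set u := bump_exponent x; set s := 2 * x - 1; set t := expR (- u).
clear dF; case: b => [|b']; case: a => [|a']; rewrite /= ?exprS; ring.
Unshelve. all: by end_near.
Qed.


Definition bdiff h (g : R -> R) x : R := g x - g (x - h).

Lemma is_derive_iter_bdiff m h (g dg : R -> R) :
  (forall x, is_derive x 1 g (dg x)) ->
  forall x, is_derive x 1 (iter m (bdiff h) g) (iter m (bdiff h) dg x).
Proof.
move=> gdg; elim: m => [//|m IHm] x /=.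
have d1 : is_derive x 1 (fun y : R => y - h) 1.
  by apply: is_derive_eq (is_deriveB (is_derive_id _ _) (is_derive_cst _ _ _)) _; rewrite subr0.
apply: is_derive_eq (is_deriveB (IHm x) (is_derive1_comp (IHm _) d1)) _.
by rewrite mulr1.
Qed.

Lemma iter_bdiff_lincomb m h (g1 g2 g3 : R -> R) c1 c2 c3 x :
  iter m (bdiff h) (fun y => c1 * g1 y + c2 * g2 y - c3 * g3 y) x =
  c1 * iter m (bdiff h) g1 x + c2 * iter m (bdiff h) g2 x - c3 * iter m (bdiff h) g3 x.
Proof.
elim: m x => [//|m IHm] x /=.
by rewrite /bdiff !IHm; ring.
Qed.

(** Iterated differences commute with differentiation, so the mean value theorem trades one
    difference for a factor [h] and one derivative. *)
Lemma iter_bdiff_deriv_le m h (g dg : R -> R) (K : R) : 0 < h ->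
  (forall x, is_derive x 1 g (dg x)) ->
  (forall x, `|iter m (bdiff h) dg x| <= K) ->
  forall x, `|iter m.+1 (bdiff h) g x| <= h * K.
Proof.
move=> h0 gdg dgK x.
have dG := @is_derive_iter_bdiff m h g dg gdg.
have xh : x - h <= x by rewrite gerBl ltW.
have cG : {within `[x - h, x], continuous (iter m (bdiff h) g)}.
  by apply: derivable_within_continuous => y _; apply: ex_derive.
have [c _ Ec] := MVT_segment xh (fun y _ => dG y) cG.
have -> : iter m.+1 (bdiff h) g x = iter m (bdiff h) g x - iter m (bdiff h) g (x - h) by [].
rewrite Ec.
by rewrite opprB addrC subrK normrM mulrC (gtr0_norm h0) ler_wpM2l // ltW.
Qed.

(** Each derivative raises [a] by at most 1 and [b] by at most 2, and its coefficients sum to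
    [2 a + b + 1 <= 5 M]; the monomials reached at the end are bounded by [(2 M)!]. *)
Lemma iter_bdiff_bump_mono_le M m h a b x : (a + m <= M)%N -> (b + 2 * m <= 2 * M)%N ->
  0 < h ->
  `|iter m (bdiff h) (bump_mono a b) x| <= (5 * M%:R * h) ^+ m * (2 * M)`!%:R.
Proof.
move=> + + h0; elim: m a b x => [|m IHm] a b x aM bM.
  rewrite expr0 mul1r; apply: le_trans (bump_mono_le _ _ _) _.
  by rewrite ler_nat leq_fact; lia.
set K := (5 * M%:R * h) ^+ m * (2 * M)`!%:R.
have K0 : 0 <= K by rewrite mulr_ge0 ?exprn_ge0 ?mulr_ge0 ?ler0n // ltW.
have -> : (5 * M%:R * h) ^+ m.+1 * (2 * M)`!%:R = h * (5 * M%:R * K).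
  by rewrite exprS /K; ring.
apply: (iter_bdiff_deriv_le h0 (is_derive_bump_mono a b)) => y.
have eq1 : (fun x0 => 2 * a%:R * bump_mono a.-1 b x0 + b%:R * bump_mono a.+1 b.+1 x0
   - bump_mono a.+1 b.+2 x0) = (fun x0 => 2 * a%:R * bump_mono a.-1 b x0
   + b%:R * bump_mono a.+1 b.+1 x0 - 1 * bump_mono a.+1 b.+2 x0).
  by apply: funext => z; rewrite mul1r.
rewrite eq1 iter_bdiff_lincomb.
have H1 := IHm a.-1 b y ltac:(lia) ltac:(lia).
have H2 := IHm a.+1 b.+1 y ltac:(lia) ltac:(lia).
have H3 := IHm a.+1 b.+2 y ltac:(lia) ltac:(lia).
rewrite -/K in H1 H2 H3.
have : `|2 * a%:R| + `|b%:R| + 1 <= (5 * M%:R : R).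
  rewrite -natrM !normr_nat -!natrD -natrM natr1 ler_nat; lia.
move: (iter m _ _ y) (iter m _ _ y) (iter m _ _ y) H1 H2 H3 => p1 p2 p3 H1 H2 H3 H.
apply: le_trans (ler_normB _ _) _; rewrite mul1r.
apply: le_trans (lerD (ler_normD _ _) (lexx _)) _; rewrite !normrM.
have A1 : 0 <= `|2 * a%:R : R| by [].
have A2 : 0 <= `|b%:R : R| by [].
apply: (@le_trans _ _ ((`|2 * a%:R| + `|b%:R| + 1) * K)); last by rewrite ler_wpM2r.
rewrite -normrM !mulrDl mul1r.
by rewrite !lerD // ler_wpM2l.
Qed.

Definition bump_fun x : R := if 0 < x < 1 then expR (- bump_exponent x) else 0.

Lemma bumpE : bump_fun = bump_mono 0 0.
Proof. by apply: funext => x; rewrite /bump_fun /bump_mono !expr0 !mul1r. Qed.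

Lemma bump_ge0 x : 0 <= bump_fun x.
Proof. by rewrite /bump_fun; case: ifP; rewrite ?expR_ge0. Qed.

Lemma bump_le1 x : bump_fun x <= 1.
Proof. by have := bump_mono_le 0 0 x; rewrite -bumpE ger0_norm ?bump_ge0. Qed.

Lemma bump_eq0 x : ~~ (0 < x < 1) -> bump_fun x = 0.
Proof. by rewrite /bump_fun => /negbTE ->. Qed.

Lemma factorial_le_expn n : (n`! <= n ^ n)%N.
Proof.
elim: n => [//|n IHn]; rewrite factS expnS leq_mul2l /=.
by apply: leq_trans IHn _; case: n => // n; rewrite leq_exp2r.
Qed.

(** The bump function is Gevrey of order 3; the power [m ^ 3] is what limits the exponent in
    the final estimate. *)
Lemma iter_bdiff_bump_le m h x : 0 < h ->
  `|iter m (bdiff h) bump_fun x| <= (20 * m%:R ^+ 3 * h) ^+ m.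
Proof.
move=> h0; rewrite bumpE.
apply: le_trans (@iter_bdiff_bump_mono_le m m h 0 0 x _ _ h0) _; rewrite ?add0n //.
have -> : (20 * m%:R ^+ 3 * h) ^+ m = (5 * m%:R * h) ^+ m * ((2 * m) ^ (2 * m))%N%:R :> R.
  by rewrite natrX natrM exprM -exprMn; congr (_ ^+ _); ring.
rewrite ler_wpM2l ?ler_nat ?factorial_le_expn //.
by rewrite exprn_ge0 // !mulr_ge0 // ltW.
Qed.

Lemma bump_lipschitz x y : `|bump_fun x - bump_fun y| <= 20 * `|x - y|.
Proof.
wlog yx : x y / y < x.
  move=> H; case: (ltgtP x y) => [xy|yx|->]; last by rewrite !subrr normr0 mulr0.
    by rewrite distrC (distrC x) H.
  exact: H.
have xy0 : 0 < x - y by rewrite subr_gt0.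
have := iter_bdiff_bump_le 1 x xy0.
by rewrite /= /bdiff subKr expr1n mulr1 expr1 (gtr0_norm xy0).
Qed.

End Bump.
(** * Exponential sums *)

Section Cis.
Variable R : realType.
Implicit Types (x y t : R).

Lemma cisD x y : cis (x + y) = cis x * cis y :> R[i].
Proof. by rewrite /cis cosD sinD; apply/eqP; rewrite eq_complex /= eqxx [sin x * _ + _]addrC eqxx. Qed.

Lemma cis0 : cis 0 = 1 :> R[i].
Proof. by rewrite /cis cos0 sin0. Qed.

Lemma normc_cis x : normc (cis x) = 1.
Proof. by rewrite /= cos2Dsin2 sqrtr1. Qed.

Lemma cis_natM n x : cis (n%:R * x) = cis x ^+ n.
Proof.
elim: n => [|n IHn]; first by rewrite mul0r cis0.
by rewrite -addn1 natrD mulrDl mul1r cisD IHn exprD.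
Qed.

Lemma cis_2pi_int (n : int) : cis (2 * pi * n%:~R) = 1 :> R[i].
Proof.
have E m : cis (2 * pi * m%:R) = 1 :> R[i].
  rewrite mulrC cis_natM; suff -> : cis (2 * pi) = 1 :> R[i] by rewrite expr1n.
  by rewrite mulr_natl /cis cos2pi sin2pi.
case: n => n; first exact: E.
rewrite NegzE mulrNz mulrN; have := cisD (2 * pi * n.+1%:R) (- (2 * pi * n.+1%:R)).
by rewrite subrr cis0 E mul1r.
Qed.

Lemma normc_ge0 (u : R[i]) : 0 <= normc u.
Proof. by case: u => a b; exact: sqrtr_ge0. Qed.

Lemma normc_le_ReIm (u : R[i]) : normc u <= `|complex.Re u| + `|complex.Im u|.
Proof.
case: u => a b /=; rewrite -[leRHS]ger0_norm ?addr_ge0 // -sqrtr_sqr ler_wsqrtr //.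
rewrite sqrrD !real_normK ?num_real // lerD2r lerDl.
by rewrite mulrn_wge0 // mulr_ge0.
Qed.

Lemma cis_lipschitz x y : normc (cis x - cis y) <= 2 * `|x - y|.
Proof.
wlog yx : x y / y <= x.
  move=> H; case: (leP y x) => [yx|/ltW xy]; first exact: H.
  by rewrite -normcN opprB distrC; exact: H.
have lip (f df : R -> R) : (forall z : R, is_derive z 1 f (df z)) ->
    (forall z : R, `|df z| <= 1) -> `|f x - f y| <= `|x - y|.
  move=> fdf df1.
  have cf : {within `[y, x], continuous f}.
    by apply: derivable_within_continuous => z _; apply: ex_derive.
  have [c _ ->] := MVT_segment yx (fun z _ => fdf z) cf.
  by rewrite normrM ler_piMl.
apply: le_trans (normc_le_ReIm _) _; rewrite mulr_natl mulr2n /= lerD //.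
  apply: (lip cos (fun z => - sin z)) => z; rewrite normrN ler_norml.
  by rewrite sin_geN1 sin_le1.
by apply: (lip sin cos) => z; rewrite ler_norml cos_geN1 cos_le1.
Qed.

(** Half of Jordan's inequality: [sin (2 y) = 2 sin y cos y], [sin y] is [y] times a
    cosine, and both cosines are at least [1 / sqrt 2] on [0, pi / 4]. *)
Lemma sin_2x_ge x : 0 <= x <= pi / 4 -> x <= sin (x *+ 2).
Proof.
case/andP=> x0 x4.
have c2 t : 0 <= t <= x -> 0 <= cos t /\ 1 <= 2 * cos t ^+ 2.
  case/andP=> t0 tx; split.
    by apply: cos_ge0_pihalf; have := pi_ge0 R; lra.
  suff : 0 <= cos (t *+ 2) by rewrite cos_mulr2n -mulr_natl; lra.
  by rewrite -mulr_natl; apply: cos_ge0_pihalf; have := pi_ge0 R; lra.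
have cs : {within `[0, x], continuous (sin : R -> R)}.
  by apply: derivable_within_continuous => z _; apply: ex_derive.
have [c] := MVT_segment x0 (fun z _ => is_derive_sin z) cs.
rewrite in_itv /= => c0x; rewrite sin0 !subr0 => sx.
have [cc0 cc1] := c2 c c0x.
have [cx0 cx1] := c2 x ltac:(by rewrite x0 lexx).
rewrite sin_mulr2n sx mulrA -mulr_natl mulrA ler_peMl //.
rewrite mulr_natl -(@ler_pXn2r _ 2) ?nnegrE ?mulrn_wge0 ?mulr_ge0 //.
rewrite expr1n -mulr_natl !exprMn; nra.
Qed.

(** By periodicity [alpha] may be replaced by its difference [x] to the nearest integer, and
    [|1 - cis (2 pi x)| = 2 |sin (pi x)|]. *)
Lemma normc_1Bcis_ge (alpha delta : R) : (forall n : int, delta <= `|alpha - n%:~R|) ->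
  2 * delta <= normc (1 - cis (2 * pi * alpha)).
Proof.
move=> Hd; pose n := Num.floor (alpha + 2^-1); pose x := alpha - n%:~R.
have xle : `|x| <= 2^-1.
  have /andP[] := floor_itv (alpha + 2^-1); rewrite -/n intrD1 => n1 n2.
  by rewrite /x ler_norml; apply/andP; split; lra.
have dx : delta <= `|x| by exact: Hd.
have -> : cis (2 * pi * alpha) = cis (2 * pi * x).
  rewrite -[LHS]mulr1 -(cis_2pi_int (- n)) -cisD /x mulrNz; congr cis; ring.
have nE : normc (1 - cis (2 * pi * x)) = 2 * `|sin (pi * x)|.
  have E : cos (2 * pi * x) = 1 - 2 * sin (pi * x) ^+ 2.
    rewrite -mulrA mulr_natl cos_mulr2n cos2sin2 -mulr_natl; ring.
  have E2 : sin (2 * pi * x) ^+ 2 = 1 - cos (2 * pi * x) ^+ 2.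
    by rewrite sin2cos2.
  rewrite /= sub0r sqrrN E2 E.
  rewrite (_ : _ + _ = (2 * `|sin (pi * x)|) ^+ 2); last first.
    by rewrite exprMn real_normK ?num_real //; ring.
  by rewrite sqrtr_sqr ger0_norm // mulr_ge0.
rewrite nE; apply: ler_wpM2l => //; apply: le_trans dx _.
wlog x0 : x xle {nE} / 0 <= x.
  move=> H; case: (leP 0 x) => [|x0]; first exact: H.
  rewrite -(normrN x) -(normrN (sin _)) -sinN -mulrN; apply: H.
    by rewrite normrN.
  by rewrite oppr_ge0 ltW.
rewrite ger0_norm //; rewrite ger0_norm // in xle.
apply: le_trans (ler_norm _).
have p2 := pi_ge2 R.
have := @sin_2x_ge (pi * x / 2).
rewrite (_ : (pi * x / 2) *+ 2 = pi * x); last by rewrite mulr2n; lra.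
by move=> /(_ ltac:(apply/andP; split; nra)); nra.
Qed.

End Cis.

Section ExpSum.
Variable R : realType.
Implicit Types (alpha delta : R) (N m n : nat).

Lemma iter_bdiff_bump_supp m (h x : R) : 0 < h -> (x <= 0) || (1 + m%:R * h <= x) ->
  iter m (bdiff h) (@bump_fun R) x = 0.
Proof.
move=> h0; elim: m x => [|m IHm] x H /=.
  apply: bump_eq0; move: H; rewrite mul0r addr0 negb_and -!leNgt.
  by [].
rewrite /bdiff !IHm ?subrr //; apply/orP; move/orP: H => [H|H]; [left|right|left|right];
  move: H; rewrite -?natr1; nra.
Qed.

(** Summation by parts, [m] times: each step trades a factor [1 - z] for a
    backward difference. *)
Lemma sum_bump_by_parts N m (z : R[i]) : (0 < N)%N ->
  (1 - z) ^+ m * (\sum_(n < N) (bump_fun (n%:R / N%:R))%:C * z ^+ n) =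
  \sum_(n < N + m) (iter m (bdiff N%:R^-1) (@bump_fun R) (n%:R / N%:R))%:C * z ^+ n.
Proof.
move=> N0; have h0 : 0 < (N%:R : R)^-1 by rewrite invr_gt0 ltr0n.
have Nn0 : (N%:R : R) != 0 by rewrite pnatr_eq0 -lt0n.
elim: m => [|m IHm]; first by rewrite expr0 mul1r addn0.
rewrite exprS -mulrA IHm mulrBl mul1r.
set G := iter m _ _; rewrite addnS.
have -> : \sum_(n < (N + m).+1) (iter m.+1 (bdiff N%:R^-1) (@bump_fun R) (n%:R / N%:R))%:C * z ^+ n
  = \sum_(n < (N + m).+1) ((G (n%:R / N%:R))%:C * z ^+ n
      - (G (n%:R / N%:R - N%:R^-1))%:C * z ^+ n).
  by apply: eq_bigr => n _; rewrite /= /bdiff -/G rmorphB mulrBl.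
rewrite sumrB; congr (_ - _).
  rewrite big_ord_recr /= [G _]iter_bdiff_bump_supp ?mul0r ?addr0 //.
  by apply/orP; right; rewrite natrD mulrDl divff.
rewrite big_ord_recl /= [G _]iter_bdiff_bump_supp ?mul0r ?add0r; last 2 first.
- by [].
- by rewrite oppr_le0 (ltW h0).
rewrite mulr_sumr; apply: eq_bigr => n _.
rewrite /bump /= add1n exprS mulrCA; congr (_%:C * _); congr G.
by rewrite -natr1 mulrDl mul1r addrK.
Qed.

Lemma normc_sum (I : Type) (r : seq I) (P : pred I) (F : I -> R[i]) :
  normc (\sum_(i <- r | P i) F i) <= \sum_(i <- r | P i) normc (F i).
Proof.
elim/big_rec2: _ => [|i y x _ H]; first by rewrite normc0.
by apply: le_trans (le_normcD _ _) _; rewrite lerD2l.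
Qed.

Lemma normcX (z : R[i]) n : normc (z ^+ n) = normc z ^+ n.
Proof. by elim: n => [|n IHn]; rewrite ?expr0 ?normc1 // !exprS normcM IHn. Qed.

Lemma normc_real (x : R) : normc x%:C = `|x|.
Proof. by rewrite /= expr0n /= addr0 sqrtr_sqr. Qed.

Lemma bump_expsum_le N m alpha delta : (0 < N)%N -> 0 < delta ->
  (forall n : int, delta <= `|alpha - n%:~R|) ->
  normc (\sum_(n < N) (bump_fun (n%:R / N%:R))%:C * cis (2 * pi * alpha) ^+ n)
  <= (N + m)%:R * (10 * m%:R ^+ 3 / (N%:R * delta)) ^+ m.
Proof.
move=> N0 d0 Hd; set z := cis _; set S := \sum_(n < N) _.
have Nr0 : 0 < (N%:R : R) by rewrite ltr0n.
have zge : 2 * delta <= normc (1 - z) by exact: normc_1Bcis_ge.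
have HS : (2 * delta) ^+ m * normc S <= normc ((1 - z) ^+ m * S).
  rewrite normcM normcX ler_wpM2r ?normc_ge0 //.
  by rewrite lerXn2r ?nnegrE ?normc_ge0 // mulr_ge0 // ltW.
have HD : normc ((1 - z) ^+ m * S) <= (N + m)%:R * (20 * m%:R ^+ 3 * N%:R^-1) ^+ m.
  rewrite sum_bump_by_parts //; apply: le_trans (normc_sum _ _ _) _.
  have -> : (N + m)%:R * (20 * m%:R ^+ 3 * N%:R^-1) ^+ m =
    \sum_(n < N + m) (20 * m%:R ^+ 3 * (N%:R : R)^-1) ^+ m.
    by rewrite sumr_const card_ord mulr_natl.
  apply: ler_sum => n _; rewrite normcM normcX normc_cis expr1n mulr1 normc_real.
  by apply: iter_bdiff_bump_le; rewrite invr_gt0.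
have D0 : 0 < (2 * delta) ^+ m by rewrite exprn_gt0 // mulr_gt0.
have -> : (10 * m%:R ^+ 3 / (N%:R * delta)) ^+ m
   = (20 * m%:R ^+ 3 * (N%:R : R)^-1) ^+ m / (2 * delta) ^+ m.
  by rewrite -expr_div_n; congr (_ ^+ _); field; rewrite !gt_eqF.
by rewrite mulrA ler_pdivlMr // mulrC (le_trans HS).
Qed.

End ExpSum.

(** * Riemann sums of the bump function *)

Section BumpRiemann.
Variable R : realType.
Local Notation mu := (@lebesgue_measure R).

Definition bump_integral : R :=
  \int[mu]_(s in `]0, 1[) expR (- (s^-1 * (1 - s)^-1)).

Lemma wbarE (x : R) : wbar x = bump_integral^-1 * bump_fun x.
Proof. by rewrite /wbar /bump_fun; case: ifP => //; rewrite mulr0. Qed.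

Lemma continuous_bump : continuous (@bump_fun R).
Proof.
by move=> x; apply: differentiable_continuous; apply/derivable1_diffP; rewrite bumpE;
  have /@ex_derive := is_derive_bump_mono 0 0 x.
Qed.

Lemma bump_primitive : exists F : R -> R,
  (forall x : R, 0 <= x <= 1 -> is_derive x 1 F (bump_fun x)) /\ F 1 - F 0 = bump_integral.
Proof.
exists (fun x => \int[mu]_(t in [set` `[-1, x]]) bump_fun t); split.
  move=> x /andP[x0 x1].
  have int2 : mu.-integrable `[-1, 2] (EFin \o @bump_fun R).
    apply: continuous_compact_integrable; first exact: segment_compact.
    exact/continuous_subspaceT/continuous_bump.
  have [||| dF EF] := @continuous_FTC1 R (@bump_fun R) (BLeft (-1)) x 2 _ int2 _ _.
  - lra.
  - by rewrite lte_fin; lra.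
  - exact: continuous_bump.
  apply: DeriveDef; first exact: dF.
  by rewrite -derive1E EF.
rewrite /bump_integral.
have E0 : \int[mu]_(t in [set` `[-1, 0]]) bump_fun t = 0.
  rewrite (@eq_Rintegral _ _ _ mu _ (cst 0)).
    by rewrite Rintegral_cst ?mul0r.
  move=> x; rewrite inE /= in_itv /= => /andP[_ x0].
  by rewrite bump_eq0 // negb_and -!leNgt x0.
rewrite E0 subr0 Rintegral_mkcond [RHS]Rintegral_mkcond.
apply: eq_Rintegral => x _.
rewrite !patchE !mem_setE !in_itv /= /bump_fun.
have [x01|nx] := boolP (0 < x < 1); last by case: ifP.
by case/andP: x01 => x0 x1; rewrite ifT //; apply/andP; split; lra.
Qed.

Lemma bump_integral_gt0 : 0 < bump_integral.
Proof.
have [F [dF <-]] := bump_primitive.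
have step (a b : R) : 0 <= a -> a <= b -> b <= 1 ->
    exists2 c, a <= c <= b & F b - F a = bump_fun c * (b - a).
  move=> a0 ab b1.
  have dab (x : R) : x \in `[a, b] -> is_derive x 1 F (bump_fun x).
    by rewrite in_itv /= => /andP[ax xb]; apply: dF; lra.
  have cF : {within `[a, b], continuous F}.
    by apply: derivable_within_continuous => x /dab dx; apply: ex_derive.
  have [c] := MVT_segment ab (fun x xab => dab x (subset_itv_oo_cc xab)) cF.
  by rewrite in_itv /= => cab Fc; exists c.
have [c1 _ E1] := step 0 (1/4) ltac:(lra) ltac:(lra) ltac:(lra).
have [c2 c2P E2] := step (1/4) (3/4) ltac:(lra) ltac:(lra) ltac:(lra).
have [c3 _ E3] := step (3/4) 1 ltac:(lra) ltac:(lra) ltac:(lra).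
have P1 := bump_ge0 c1; have P3 := bump_ge0 c3.
have P2 : 0 < bump_fun c2.
  by rewrite /bump_fun ifT ?expR_gt0 //; case/andP: c2P => ? ?; apply/andP; split; lra.
nra.
Qed.

(** Between consecutive nodes the mean value theorem compares the increment of a primitive
    with the value at the left node, up to the Lipschitz constant 20 times [1 / N^2]. *)
Lemma bump_riemann N : (0 < N)%N ->
  `|\sum_(n < N) bump_fun (n%:R / N%:R) - N%:R * bump_integral| <= 20.
Proof.
move=> N0; have [F [dF <-]] := bump_primitive.
have Nr0 : 0 < (N%:R : R) by rewrite ltr0n.
have -> : N%:R * (F 1 - F 0) =
    \sum_(n < N) N%:R * (F (n.+1%:R / N%:R) - F (n%:R / N%:R)).
  rewrite -mulr_sumr -(big_mkord xpredT (fun n => F (n.+1%:R / N%:R) - F (n%:R / N%:R))).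
  by rewrite telescope_sumr // mul0r divff // gt_eqF.
rewrite -sumrB; apply: le_trans (ler_norm_sum _ _ _) _.
have -> : (20 : R) = \sum_(n < N) 20 / N%:R.
  by rewrite sumr_const card_ord -[RHS]mulr_natr divfK // gt_eqF.
apply: ler_sum => n _.
set a := n%:R / N%:R; set b := n.+1%:R / N%:R.
have ba : b - a = N%:R^-1 by rewrite /a /b -mulrBl -natr1 addrAC subrr add0r mul1r.
have h0 : 0 < (N%:R : R)^-1 by rewrite invr_gt0.
have ab : a <= b by rewrite -subr_ge0 ba ltW.
have a0 : 0 <= a by rewrite divr_ge0.
have b1 : b <= 1 by rewrite ler_pdivrMr // mul1r ler_nat.
have dab (x : R) : x \in `[a, b] -> is_derive x 1 F (bump_fun x).
  by rewrite in_itv /= => /andP[ax xb]; apply: dF; lra.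
have cF : {within `[a, b], continuous F}.
  by apply: derivable_within_continuous => x /dab dx; apply: ex_derive.
have [c] := MVT_segment ab (fun x xab => dab x (subset_itv_oo_cc xab)) cF.
rewrite in_itv /= => /andP[ac cb] ->.
rewrite ba mulrCA divff ?gt_eqF // mulr1.
apply: le_trans (bump_lipschitz _ _) _.
by rewrite ler_wpM2l // distrC ger0_norm -?ba; lra.
Qed.

End BumpRiemann.
(** * The frequency lattice *)

Section Lattice.
Variables (R : realType) (eta : nat).
Implicit Types (k : nat -> int) (x : nat -> R).

Lemma eta_term_le k j : Zstar R eta k ->
  (maxn 1 j ^ eta * `|k j|)%N%:R <= eta_norm R eta k.
Proof.
move=> kZ; rewrite -lee_fin /eta_norm fineK; last first.
  by rewrite ge0_fin_numE // nneseries_ge0 // => n _ _; rewrite lee_fin.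
apply: le_trans (nneseries_lim_ge j.+1 _); last by move=> n _ _; rewrite lee_fin.
rewrite big_nat_recr //= leeDr // sume_ge0 // => n _; by rewrite lee_fin.
Qed.

Lemma eta_norm_ge1 k : Zstar R eta k -> k != 0 -> 1 <= eta_norm R eta k.
Proof.
move=> kZ k0; have [j kj] : exists j, k j != 0.
  apply: contrapT => H; case/negP: k0; apply/eqP/funext => j.
  by apply/eqP/negPn/negP => kj; apply: H; exists j.
apply: le_trans (eta_term_le j kZ).
by rewrite (ler_nat _ 1) muln_gt0 expn_gt0 absz_gt0 kj leq_max.
Qed.

Hypothesis eta_gt0 : (0 < eta)%N.

(** The weight [<j>^eta] is at least [j], so the norm bounds the position of the last nonzero
    entry as well as the size of the entries. *)
Lemma Zstar_support k (n : nat) : Zstar R eta k -> eta_norm R eta k < n%:R ->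
  forall j, (n <= j)%N -> k j = 0.
Proof.
move=> kZ kn j nj; apply/eqP/negPn/negP => kj.
have := le_lt_trans (eta_term_le j kZ) kn; rewrite ltr_nat ltnNge => /negP; apply.
apply: leq_trans nj _; apply: (@leq_trans (maxn 1 j)); first exact: leq_maxr.
apply: (@leq_trans (maxn 1 j ^ eta)).
  by rewrite -{1}(expn1 (maxn 1 j)) leq_pexp2l // leq_max.
by rewrite leq_pmulr // absz_gt0.
Qed.

Lemma Zstar_finite_support k : Zstar R eta k ->
  exists n, forall j, (n <= j)%N -> k j = 0.
Proof.
move=> kZ; exists (Num.bound `|eta_norm R eta k|); apply: Zstar_support => //.
by apply: le_lt_trans (ler_norm _) (archi_boundP _).
Qed.

Lemma finite_Zstar_le (K : R) :
  finite_set [set k | Zstar R eta k /\ eta_norm R eta k <= K].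
Proof.
pose n := Num.bound `|K|.
have Kn : K < n%:R by apply: le_lt_trans (ler_norm _) (archi_boundP _).
pose f (u : {ffun 'I_n -> 'I_(n + n)}) : nat -> int :=
  fun j => if insub j is Some i then (u i)%:Z - n%:Z else 0.
apply: (@sub_finite_set _ _ (f @` setT)); last first.
  exact/finite_image/finite_finset.
move=> k [kZ kK]; have kn := le_lt_trans kK Kn.
have kb j : (`|k j| < n)%N.
  have := le_lt_trans (eta_term_le j kZ) kn; rewrite ltr_nat.
  by apply: leq_ltn_trans; rewrite leq_pmull // expn_gt0 leq_max.
have kb2 j : (`|(k j + n%:Z)%R|%N < n + n)%N by have := kb j; lia.
exists [ffun i : 'I_n => Ordinal (kb2 i)] => //.
apply: funext => j; rewrite /f; case: insubP => [i _ <-|nj].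
  by rewrite ffunE /=; have := kb i; lia.
by rewrite (Zstar_support kZ kn) // leqNgt.
Qed.

Lemma Zstar0 : Zstar R eta (0 : nat -> int).
Proof.
rewrite /Zstar /= /eta_enorm eseries0 ?ltry // => i _ _.
by rewrite /= muln0.
Qed.

Lemma dotE k x n : (forall j, (n <= j)%N -> k j = 0) ->
  dot k x = \sum_(j < n) (k j)%:~R * x j.
Proof.
move=> kn; rewrite /dot (fsbig_ord _ n (fun j => (k j)%:~R * x j)); apply/esym/fsbig_widen => // j [_ /= /negP].
by rewrite -leqNgt => /kn ->; rewrite mul0r.
Qed.

Lemma dotD k x y : Zstar R eta k -> dot k (fun j => x j + y j) = dot k x + dot k y.
Proof.
move=> /Zstar_finite_support[n kn]; rewrite !(dotE _ kn) -big_split /=.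
by apply: eq_bigr => j _; rewrite mulrDr.
Qed.

Lemma dotZ k x (a : R) : Zstar R eta k -> dot k (fun j => a * x j) = a * dot k x.
Proof.
move=> /Zstar_finite_support[n kn]; rewrite !(dotE _ kn) mulr_sumr.
by apply: eq_bigr => j _; rewrite mulrCA.
Qed.

Lemma dot_int k (z : nat -> int) : Zstar R eta k ->
  exists m : int, dot k (fun j => (z j)%:~R : R) = m%:~R.
Proof.
move=> /Zstar_finite_support[n kn]; exists (\sum_(j < n) k j * z j).
by rewrite (dotE _ kn) rmorph_sum; apply: eq_bigr => j _; rewrite rmorphM.
Qed.

(** Reducing the coordinates modulo 1 changes [k . theta] by an integer. *)
Lemma cis_tdot_translate k (v : nat -> R) (theta : torus R) : Zstar R eta k ->
  cis (2 * pi * tdot k (translate v theta)) =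
  cis (2 * pi * tdot k theta) * cis (2 * pi * dot k v).
Proof.
move=> kZ; rewrite /tdot /translate /mod1 /=.
pose z j := Num.floor (sval (theta j) + v j).
have -> : (fun j => sval (theta j) + v j - (Num.floor (sval (theta j) + v j))%:~R)
   = (fun j => (sval (theta j) + v j) + (-1) * (z j)%:~R).
  by apply: funext => j; rewrite mulN1r.
rewrite !dotD // dotZ //; have [m ->] := dot_int z kZ.
rewrite mulN1r -mulrNz mulrDr cisD cis_2pi_int mulr1.
by rewrite mulrDr cisD.
Qed.

End Lattice.

Section Translate.
Variable R : realType.
Implicit Types (v w : nat -> R) (theta : torus R).

Lemma translate0 theta : translate (fun=> 0) theta = theta.
Proof.
apply: funext => j; apply: eq_sig_hprop => [*|]; first exact: bool_irrelevance.
rewrite /= addr0 (floor_def (m := 0)) ?subr0 // add0r.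
by case: (theta j).
Qed.

Lemma translate_translate v w theta :
  translate v (translate w theta) = translate (fun j => w j + v j) theta.
Proof.
apply: funext => j; apply: eq_sig_hprop => [*|]; first exact: bool_irrelevance.
rewrite /=; set t := sval (theta j).
rewrite (_ : t + w j - _ + v j = t + (w j + v j) + (- Num.floor (t + w j))%:~R); last first.
  by rewrite mulrNz; lra.
rewrite [Num.floor (_ + _%:~R)]floorDrz ?intr_int // intrKfloor mulrNz intrD mulrNz; lra.
Qed.

Lemma iter_translate (n : nat) v theta :
  iter n (translate v) theta = translate (fun j => n%:R * v j) theta.
Proof.
elim: n => [|n IHn].
  rewrite -[LHS]translate0; congr translate; apply: funext => j; by rewrite mul0r.
rewrite iterS IHn translate_translate; congr translate.
by apply: funext => j; rewrite -natr1 mulrDl mul1r.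
Qed.

End Translate.
(** * Real-valued norms and unconditional sums *)

Section Rnorm.
Variables (R : realType) (B : normedModType R[i]).
Implicit Types u v : B.

Lemma rnormE v : `|v| = (rnorm v)%:C.
Proof. by rewrite /rnorm RRe_real // normr_real. Qed.

Lemma rnorm_ge0 v : 0 <= rnorm v.
Proof. by rewrite -ler0c -rnormE. Qed.

Lemma rnorm0 : rnorm (0 : B) = 0.
Proof. by rewrite /rnorm normr0. Qed.

Lemma rnormD u v : rnorm (u + v) <= rnorm u + rnorm v.
Proof. by rewrite -lecR rmorphD /= -!rnormE ler_normD. Qed.

Lemma rnormZ (c : R[i]) v : rnorm (c *: v) = normc c * rnorm v.
Proof. by apply: complexI; rewrite rmorphM /= -!rnormE normrZ. Qed.

Lemma rnormN v : rnorm (- v) = rnorm v.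
Proof. by rewrite /rnorm normrN. Qed.

Lemma rnorm_distC u v : rnorm (u - v) = rnorm (v - u).
Proof. by rewrite -rnormN opprB. Qed.

Lemma rnorm_sub_le u v w : rnorm (u - w) <= rnorm (u - v) + rnorm (v - w).
Proof. by rewrite (le_trans _ (rnormD _ _)) // addrA subrK. Qed.

Lemma rnorm_sum (I : Type) (r : seq I) (P : pred I) (F : I -> B) :
  rnorm (\sum_(i <- r | P i) F i) <= \sum_(i <- r | P i) rnorm (F i).
Proof.
elim/big_rec2: _ => [|i y x _ H]; first by rewrite rnorm0.
by apply: le_trans (rnormD _ _) _; rewrite lerD2l.
Qed.

End Rnorm.

Section HasSum.
Variables (R : realType) (B : completeNormedModType R[i]) (I : choiceType).
Implicit Types (A : set I) (u : I -> B) (v a : B) (F : {fset I}).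

Lemma has_sumZ A u v (c : R[i]) : has_sum A u v ->
  has_sum A (fun i => c *: u i) (c *: v).
Proof.
move=> uv e e0.
have c1 : 0 < normc c + 1 by have := normc_ge0 c; lra.
have [F0 [F0A H]] := uv _ (divr_gt0 e0 c1).
exists F0; split=> // F F0F FA.
rewrite -scaler_sumr -scalerBr rnormZ.
have := H F F0F FA; rewrite ltr_pdivlMr //.
have := rnorm_ge0 (\sum_(i <- F) u i - v); have := normc_ge0 c; nra.
Qed.

Lemma has_sumD A u1 u2 v1 v2 : has_sum A u1 v1 -> has_sum A u2 v2 ->
  has_sum A (fun i => u1 i + u2 i) (v1 + v2).
Proof.
move=> H1 H2 e e0; have e2 : 0 < e / 2 by rewrite divr_gt0.
have [F1 [F1A P1]] := H1 _ e2; have [F2 [F2A P2]] := H2 _ e2.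
exists (F1 `|` F2)%fset; split=> [i /=|F sF FA].
  by rewrite in_fsetU => /orP[/F1A|/F2A].
have sF1 : [set` F1] `<=` [set` F].
  by move=> i iF; apply: sF; rewrite /= in_fsetU; apply/orP; left.
have sF2 : [set` F2] `<=` [set` F].
  by move=> i iF; apply: sF; rewrite /= in_fsetU; apply/orP; right.
have L1 := P1 F sF1 FA; have L2 := P2 F sF2 FA.
rewrite big_split /= opprD addrACA.
by apply: le_lt_trans (rnormD _ _) _; rewrite [e]splitr ltrD.
Qed.

Lemma has_sum0 A : has_sum A (fun=> 0 : B) 0.
Proof.
move=> e e0; exists fset0; split=> [i|F _ _]; first by rewrite /= in_fset0.
by rewrite big1 // subr0 rnorm0.
Qed.

Lemma has_sum_sum A (N : nat) (u : nat -> I -> B) (v : nat -> B) :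
  (forall n, has_sum A (u n) (v n)) ->
  has_sum A (fun i => \sum_(n < N) u n i) (\sum_(n < N) v n).
Proof.
move=> uv; elim: N => [|N IHN].
  rewrite big_ord0 (_ : (fun=> _) = fun=> 0); first exact: has_sum0.
  by apply: funext => i; rewrite big_ord0.
rewrite big_ord_recr /= (_ : (fun=> _) = fun i => \sum_(n < N) u n i + u N i).
  exact: has_sumD.
by apply: funext => i; rewrite big_ord_recr.
Qed.

Lemma has_sum_dist_le A u v a F1 (C : R) : has_sum A u v -> [set` F1] `<=` A ->
  (forall F, [set` F1] `<=` [set` F] -> [set` F] `<=` A ->
    rnorm (\sum_(i <- F) u i - a) <= C) ->
  rnorm (v - a) <= C.
Proof.
move=> uv F1A H; apply/ler_addgt0Pr => e e0.
have [F0 [F0A P0]] := uv _ e0.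
have FA : [set` (F0 `|` F1)%fset] `<=` A.
  by move=> i /=; rewrite in_fsetU => /orP[/F0A|/F1A].
have sF0 : [set` F0] `<=` [set` (F0 `|` F1)%fset].
  by move=> i iF; rewrite /= in_fsetU; apply/orP; left.
have sF1 : [set` F1] `<=` [set` (F0 `|` F1)%fset].
  by move=> i iF; rewrite /= in_fsetU; apply/orP; right.
apply: le_trans (rnorm_sub_le _ (\sum_(i <- (F0 `|` F1)%fset) u i) _) _.
by rewrite rnorm_distC addrC lerD ?H // ltW // P0.
Qed.

End HasSum.

Lemma finite_set_bounded (R : realType) (T : choiceType) (L : set T) (h : T -> R) :
  finite_set L -> exists2 D, 0 <= D & forall t, L t -> `|h t| <= D.
Proof.
move=> fL; exists (\sum_(t <- fset_set L) `|h t|) => [|t Lt].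
  by rewrite sumr_ge0.
have tL : t \in fset_set L by rewrite in_fset_set // inE.
by rewrite (big_fsetD1 t) //= lerDl sumr_ge0.
Qed.

Lemma ler_sum_fsubset (R : numDomainType) (T : choiceType) (F G : {fset T}) (h : T -> R) :
  (F `<=` G)%fset -> (forall t, 0 <= h t) ->
  \sum_(t <- F) h t <= \sum_(t <- G) h t.
Proof.
move=> FG h0; rewrite [leRHS](big_fsetID _ (mem F)) /=.
suff -> : \sum_(t <- [fset t in G | t \in mem F]%fset) h t = \sum_(t <- F) h t.
  by rewrite lerDl sumr_ge0.
apply: eq_fbigl => t; rewrite !inE /= andbC; case: (boolP (t \in F)) => //= tF.
exact: (fsubsetP FG).
Qed.

(** * Decay and summability of the Fourier coefficients *)

Section Coefficients.
Variables (R : realType) (B : completeNormedModType R[i]).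
Variables (mu : probability (torus R) R) (eta : nat) (phi d Delta : R -> R).
Variables (gamma c : R) (f : torus R -> B).
Hypothesis eta_gt0 : (0 < eta)%N.
Hypothesis d_approx : approximation_function d.
Hypothesis Delta_approx : approximation_function Delta.
Hypothesis fB : in_BDelta mu eta Delta f.
Hypothesis trunc : truncation_condition eta phi d Delta gamma c.

Local Notation coef := (fourier_coef mu f).
Local Notation norm := (eta_norm R eta).

Definition cutoff (x : R) : R := approx_inv d (2 * pi * gamma * x / phi x).

(** The coefficients are [O(1 / Delta)], hence [O(d^2 / Delta)] because [d >= 1]. *)
Lemma fourier_coef_tail : exists2 C : R, 0 <= C &
  \forall x \near +oo, forall F : {fset nat -> int},
    (forall k, k \in F -> [/\ Zstar R eta k, k != 0 & cutoff x < norm k]) ->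
    \sum_(k <- F) rnorm (coef k) <= C * expR (- (c * x)).
Proof.
have [_ _ [M HM]] := fB; have [_ _ d1 _] := d_approx; have [_ _ D1 _] := Delta_approx.
have [M' HM'] := trunc.
exists (Num.max M 0 * Num.max M' 0); first by rewrite mulr_ge0 // le_max lexx orbT.
apply: filterS HM' => x Hx F HF.
have M0 : 0 <= Num.max M 0 by rewrite le_max lexx orbT.
apply: (@le_trans _ _ (Num.max M 0 * \sum_(k <- F) (d (norm k) ^+ 2 / Delta (norm k)))).
  rewrite mulr_sumr big_seq [leRHS]big_seq; apply: ler_sum => k /HF[kZ k0 _].
  have k1 := eta_norm_ge1 kZ k0.
  have De1 := D1 _ k1; have de1 := d1 _ k1.
  have D0 : 0 < Delta (norm k) by apply: lt_le_trans De1.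
  rewrite mulrA ler_pdivlMr // mulrC; apply: le_trans (HM k kZ k0) _.
  apply: (@le_trans _ _ (Num.max M 0)); first by rewrite le_max lexx.
  by rewrite ler_peMr // expr_ge1 // (le_trans _ de1).
rewrite -mulrA ler_wpM2l // -lee_fin.
apply: (@le_trans _ _ (M' * expR (- (c * x)))%:E); last first.
  by rewrite lee_fin ler_wpM2r ?expR_ge0 // le_max lexx.
apply: le_trans Hx; apply: esum_ge; exists [set` F].
  by split; [exact: finite_fset | move=> k /= /HF].
by rewrite -fsbig_seq ?fset_uniq // sumEFin.
Qed.

(** Only finitely many frequencies lie below a given cutoff, and the tail bound handles the
    others. *)
Lemma fourier_coef_summable : exists2 S : R, 0 <= S & forall F : {fset nat -> int},
  (forall k, k \in F -> Zstar R eta k /\ k != 0) ->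
  \sum_(k <- F) rnorm (coef k) <= S.
Proof.
have [C C0 HC] := fourier_coef_tail.
have [x Hx] : exists x, forall F : {fset nat -> int},
    (forall k, k \in F -> [/\ Zstar R eta k, k != 0 & cutoff x < norm k]) ->
    \sum_(k <- F) rnorm (coef k) <= C * expR (- (c * x)) by exact: filter_ex HC.
have fL := finite_Zstar_le (R := R) eta_gt0 (cutoff x).
exists (\sum_(k <- fset_set [set k | Zstar R eta k /\ norm k <= cutoff x]) rnorm (coef k)
   + C * expR (- (c * x))).
  by rewrite addr_ge0 ?mulr_ge0 ?expR_ge0 // sumr_ge0 // => k _; exact: rnorm_ge0.
move=> F HF; rewrite (big_fsetID _ (fun k => norm k <= cutoff x)) /= lerD //.
  apply: ler_sum_fsubset => [|k]; last exact: rnorm_ge0.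
  apply/fsubsetP => k; rewrite !inE /= => /andP[kF kl].
  by rewrite in_fset_set // inE; split => //; case: (HF k kF).
apply: Hx => k; rewrite !inE /= -ltNge => /andP[kF kh].
by have [] := HF k kF.
Qed.

(** The sum over the frequencies below the cutoff is controlled by a bound for the
    multipliers there, the rest by the decay of the coefficients alone. *)
Lemma fourier_multiplier_sum_le : exists S C : R, [/\ 0 <= S, 0 <= C &
  \forall x \near +oo, forall (z : (nat -> int) -> R) (E W : R),
    0 <= E -> 0 <= W ->
    (forall k, 0 <= z k <= W) ->
    (forall k, Zstar R eta k -> k != 0 -> norm k <= cutoff x -> z k <= E) ->
    forall F : {fset nat -> int}, (forall k, k \in F -> Zstar R eta k /\ k != 0) ->
    \sum_(k <- F) z k * rnorm (coef k) <= S * E + W * (C * expR (- (c * x)))].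
Proof.
have [C C0 HC] := fourier_coef_tail; have [S S0 HS] := fourier_coef_summable.
exists S, C; split=> //; apply: filterS HC => x Hx z E W E0 W0 zW zE F HF.
rewrite (big_fsetID _ (fun k => norm k <= cutoff x)) /= lerD //.
  apply: (@le_trans _ _ (E * \sum_(k <- [fset k in F | norm k <= cutoff x]%fset) rnorm (coef k))).
    rewrite mulr_sumr big_seq [leRHS]big_seq; apply: ler_sum => k.
    rewrite !inE /= => /andP[kF kl]; have [kZ k0] := HF k kF.
    by rewrite ler_wpM2r ?rnorm_ge0 // zE.
  rewrite mulrC ler_wpM2r // HS // => k; rewrite !inE /= => /andP[kF _]; exact: HF.
apply: (@le_trans _ _ (W * \sum_(k <- [fset k in F | ~~ (norm k <= cutoff x)]%fset) rnorm (coef k))).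
  rewrite mulr_sumr; apply: ler_sum => k _.
  by rewrite ler_wpM2r ?rnorm_ge0 //; case/andP: (zW k).
rewrite ler_wpM2l // Hx // => k; rewrite !inE /= -ltNge => /andP[kF kh].
by have [] := HF k kF.
Qed.

(** The factor by which the combination of translates with weights [w n] and vectors
    [v n] acts on the mode of frequency [k]. *)
Definition multiplier (N : nat) (w : nat -> R) (v : nat -> nat -> R) (k : nat -> int) : R[i] :=
  \sum_(n < N) (w n)%:C * cis (2 * pi * dot k (v n)).

Lemma multiplier_le N w v k : normc (multiplier N w v k) <= \sum_(n < N) `|w n|.
Proof.
apply: le_trans (normc_sum _ _ _) _; apply: ler_sum => n _.
by rewrite normcM normc_cis mulr1 normc_real.
Qed.

(** The zero mode contributes the mean, since the Bochner integral of [f] is its Fourier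
    coefficient at zero. *)
Lemma translate_average_le (N : nat) (w : nat -> R) (v : nat -> nat -> R)
    (theta : torus R) (C : R) :
  (forall F : {fset nat -> int}, (forall k, k \in F -> Zstar R eta k /\ k != 0) ->
    \sum_(k <- F) normc (multiplier N w v k) * rnorm (coef k) <= C) ->
  rnorm (\sum_(n < N) (w n)%:C *: f (translate (v n) theta)
         - (\sum_(n < N) w n)%:C *: bochner_integral mu setT f) <= C.
Proof.
move=> HC; have [_ fsum _] := fB.
have coef0 : bochner_integral mu setT f = coef 0.
  rewrite /fourier_coef; congr bochner_integral; apply: funext => t.
  rewrite /fourier_integrand (_ : tdot 0 t = 0) ?mulr0 ?oppr0 ?cis0 ?scale1r //.
  by rewrite /tdot (@dotE _ _ _ 0%N) // big_ord0.
have H := has_sum_sum N (fun n => has_sumZ (w n)%:C (fsum (translate (v n) theta))).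
apply: (has_sum_dist_le (F1 := [fset (0 : nat -> int)]%fset) H).
  by move=> k; rewrite /= inE => /eqP ->; exact: Zstar0.
move=> F F0 FZ.
have F0in : (0 : nat -> int) \in F by apply: F0; rewrite /= inE.
rewrite (big_fsetD1 _ F0in) /=.
have termE k : Zstar R eta k ->
    \sum_(n < N) (w n)%:C *: (cis (2 * pi * tdot k (translate (v n) theta)) *: coef k)
    = (multiplier N w v k * cis (2 * pi * tdot k theta)) *: coef k.
  move=> kZ; rewrite /multiplier mulr_suml scaler_suml; apply: eq_bigr => n _.
  by rewrite (cis_tdot_translate eta_gt0 _ _ kZ) scalerA; congr (_ *: _); ring.
rewrite termE; last exact: Zstar0.
rewrite coef0 (_ : multiplier N w v 0 * _ = (\sum_(n < N) w n)%:C); last first.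
  have d0 x : dot (R := R) 0 x = 0 by rewrite (@dotE _ _ _ 0%N) // big_ord0.
  rewrite /tdot d0 mulr0 cis0 mulr1 /multiplier rmorph_sum; apply: eq_bigr => n _.
  by rewrite d0 mulr0 cis0 mulr1.
rewrite addrAC subrr add0r.
apply: le_trans (rnorm_sum _ _ _) _.
have HF k : k \in (F `\ (0 : nat -> int))%fset -> Zstar R eta k /\ k != 0.
  by rewrite !inE => /andP[k0 kF]; split=> //; apply: FZ.
apply: le_trans (HC _ HF); rewrite big_seq [leRHS]big_seq; apply: ler_sum => k /HF[kZ _].
by rewrite termE // rnormZ normcM normc_cis mulr1.
Qed.

End Coefficients.
(** * Bochner integrals of uniform limits of simple functions *)

Section Tagged.
Context (dsp : measure_display) (X : measurableType dsp) (R : realType).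
Context (mu : {measure set X -> \bar R}) (D : set X).
Context (B : completeNormedModType R[i]).
Hypothesis mD : measurable D.
Hypothesis muD : (mu D < +oo)%E.

(** A function that takes finitely many values is handled through a finite measurable
    partition of the domain, given as the fibres of a map to some set of tags. The
    freedom to choose the tags, e.g. pairs of values, gives common refinements. *)
Definition finite_tag (J : choiceType) (t : X -> J) : Prop :=
  finite_set (t @` D) /\ forall p, measurable (D `&` t @^-1` [set p]).

Definition fibre_mass (J : choiceType) (t : X -> J) (p : J) : R :=
  fine (mu (D `&` t @^-1` [set p])).

Lemma finite_mass E : measurable E -> E `<=` D -> mu E \is a fin_num.
Proof.
by move=> mE ED; rewrite ge0_fin_numE // (le_lt_trans _ muD) // le_measure ?inE.
Qed.

Section OneTag.
Variables (J : choiceType) (t : X -> J).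
Hypothesis tP : finite_tag t.
Local Notation A := (fset_set (t @` D)).
Local Notation fibre p := (D `&` t @^-1` [set p]).

Lemma fibre_mass_ge0 p : 0 <= fibre_mass t p.
Proof. by rewrite fine_ge0. Qed.

Lemma mem_tags p : (p \in A) = (p \in t @` D).
Proof. by rewrite in_fset_set //; case: tP. Qed.

Lemma fibre_trivIset (Z : set J) : trivIset Z (fun p => fibre p).
Proof. by move=> p q _ _ [x [[_ xp] [_ xq]]]; rewrite -xp -xq. Qed.

Lemma fibres_preimage (Y : set J) :
  D `&` t @^-1` Y = \bigcup_(p in [set` A] `&` Y) fibre p.
Proof.
apply/seteqP; split=> [x [Dx Yx]|x [p [_ Yp] [Dx xp]]]; last first.
  by split=> //=; rewrite xp.
exists (t x) => //; split=> //=; rewrite mem_tags inE; by exists x.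
Qed.

Lemma finite_tags_setI (Y : set J) : finite_set ([set` A] `&` Y).
Proof. exact/finite_setIl/finite_fset. Qed.

Lemma measurable_tag_preimage (Y : set J) : measurable (D `&` t @^-1` Y).
Proof.
rewrite fibres_preimage; apply: fin_bigcup_measurable; first exact: finite_tags_setI.
by move=> p _; case: tP => _; apply.
Qed.

Lemma mass_tag_preimage (Y : pred J) :
  mu (D `&` t @^-1` [set p | Y p]) = (\sum_(p <- A | Y p) fibre_mass t p)%:E.
Proof.
rewrite fibres_preimage measure_fin_bigcup; first last.
- by move=> p _; case: tP => _; apply.
- exact: fibre_trivIset.
- exact: finite_tags_setI.
rewrite fsbig_finite; last exact: finite_tags_setI.
rewrite -sumEFin [RHS]big_fset_condE.
rewrite (_ : fset_set _ = [fset p in A | Y p]%fset); last first.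
  apply/fsetP => p; rewrite in_fset_set; last exact: finite_tags_setI.
  apply/idP/idP => [/set_mem [pA Yp]|].
    by rewrite inE /=; apply/andP.
  by move=> H; apply/mem_set; move: H; rewrite inE /= => /andP[].
by apply: eq_bigr => p _; rewrite /fibre_mass fineK // finite_mass //; case: tP => _; apply.
Qed.

Lemma mass_fibres : mu D = (\sum_(p <- A) fibre_mass t p)%:E.
Proof.
have := mass_tag_preimage xpredT; rewrite (_ : [set p | _] = setT) ?preimage_setT ?setIT //.
by apply/seteqP; split.
Qed.

Lemma simple_of_tag (s : X -> B) (c : J -> B) : (forall x, D x -> s x = c (t x)) ->
  is_simple mu D s /\
  simple_integral mu D s = \sum_(p <- A) (fibre_mass t p)%:C *: c p.
Proof.
move=> sc.
have preE b : D `&` s @^-1` [set b] = D `&` t @^-1` [set p | c p == b].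
  apply/seteqP; split=> x [Dx] /= H; split=> //=; first by rewrite -sc ?H.
  by rewrite sc //; apply/eqP.
have imE : s @` D = c @` (t @` D).
  by rewrite image_comp; apply/eq_imagel => x Dx; rewrite sc.
have finA : finite_set (t @` D) by case: tP.
split.
  split; first by rewrite imE; exact: finite_image.
  move=> b; rewrite preE; split=> [|_]; first exact: measurable_tag_preimage.
  apply: le_lt_trans muD; apply: le_measure; rewrite ?inE //.
  exact: measurable_tag_preimage.
rewrite /simple_integral imE fsbig_finite; last exact: finite_image.
rewrite fset_set_image // [RHS](partition_big_imfset _ c) /=.
apply: eq_bigr => b _; rewrite preE mass_tag_preimage /= rmorph_sum scaler_suml.
by apply: eq_bigr => p /eqP ->.
Qed.

Lemma integral_of_tag (h : J -> R) : (forall p, 0 <= h p) ->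
  (\int[mu]_(x in D) (h (t x))%:E = (\sum_(p <- A) fibre_mass t p * h p)%:E)%E.
Proof.
move=> h0.
have DE : D = \big[setU/set0]_(p <- A) fibre p.
  rewrite -bigcup_fset; have := fibres_preimage setT.
  by rewrite preimage_setT !setIT.
rewrite {1}DE ge0_integral_bigsetU //=; first last.
- by move=> x _; rewrite lee_fin.
- rewrite -DE; apply/measurable_EFinP => _ Y mY.
  have -> : D `&` (fun x => h (t x)) @^-1` Y = D `&` t @^-1` (h @^-1` Y) by [].
  exact: measurable_tag_preimage.
- exact: fibre_trivIset.
- by case: tP.
rewrite -sumEFin; apply: eq_bigr => p _.
rewrite (eq_integral (cst (h p)%:E)); last first.
  by move=> x; rewrite inE /= => -[_ ->].
rewrite integral_cst; last by case: tP.
by rewrite /fibre_mass mulrC EFinM fineK // finite_mass //; case: tP.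
Qed.

End OneTag.

Lemma finite_tag_of_simple (s : X -> B) : is_simple mu D s -> finite_tag s.
Proof. by case=> fs ms; split=> // b; case: (ms b). Qed.

Lemma finite_tag_pair (J1 J2 : choiceType) (t1 : X -> J1) (t2 : X -> J2) :
  finite_tag t1 -> finite_tag t2 -> finite_tag (fun x => (t1 x, t2 x)).
Proof.
move=> [f1 m1] [f2 m2]; split.
  apply: (@sub_finite_set _ _ ((t1 @` D) `*` (t2 @` D))); last exact: finite_setX.
  by move=> _ [x Dx <-]; split; exists x.
case=> p1 p2; rewrite (_ : _ `&` _ = (D `&` t1 @^-1` [set p1]) `&` (D `&` t2 @^-1` [set p2])).
  exact: measurableI.
apply/seteqP; split=> [x [Dx [/= <- <-]]|x [[Dx /= <-] [_ /= <-]]]; split=> //.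
Qed.

Lemma simple_integral_sub_le (s1 s2 : X -> B) : is_simple mu D s1 -> is_simple mu D s2 ->
  let t := fun x => (s1 x, s2 x) in
  finite_tag t /\
  rnorm (simple_integral mu D s1 - simple_integral mu D s2) <=
  \sum_(p <- fset_set (t @` D)) fibre_mass t p * rnorm (p.1 - p.2).
Proof.
move=> H1 H2 t.
have tP : finite_tag t by apply: finite_tag_pair; exact: finite_tag_of_simple.
split=> //.
have [_ ->] := simple_of_tag tP (c := fst) (fun x _ => erefl (s1 x)).
have [_ ->] := simple_of_tag tP (c := snd) (fun x _ => erefl (s2 x)).
rewrite -sumrB; apply: le_trans (rnorm_sum _ _ _) _.
apply: ler_sum => p _; rewrite -scalerBr rnormZ normc_real ger0_norm //.
exact: fibre_mass_ge0.
Qed.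

(** The integral of a nonnegative function is a supremum over the simple functions below it,
    so it is monotone on all functions. *)
Lemma le_integral_nonmeasurable (f1 f2 : X -> \bar R) :
  (forall x, D x -> (0 <= f1 x)%E) -> (forall x, D x -> (f1 x <= f2 x)%E) ->
  (\int[mu]_(x in D) f1 x <= \int[mu]_(x in D) f2 x)%E.
Proof.
move=> f10 f12.
have f20 x : D x -> (0 <= f2 x)%E by move=> Dx; apply: le_trans (f12 x Dx); exact: f10.
rewrite !ge0_integralE //; apply: ereal_sup_le => _ [h hf <-]; exists h => // x.
apply: le_trans (hf x) _; rewrite !patchE; case: ifPn => //; rewrite inE; exact: f12.
Qed.

(** Any simple function close to [g] in mean has almost the integral of one that is
    uniformly close to [g]; cutting [rnorm (s1 - s2)] at height [e] yields a simple
    function below [rnorm (g - s2)]. *)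
Lemma simple_integral_near (g s1 s2 : X -> B) (e del : R) : 0 <= e ->
  is_simple mu D s1 -> is_simple mu D s2 ->
  (forall x, D x -> rnorm (g x - s1 x) <= e) ->
  (\int[mu]_(x in D) (rnorm (g x - s2 x))%:E <= del%:E)%E ->
  rnorm (simple_integral mu D s1 - simple_integral mu D s2) <= del + e * fine (mu D).
Proof.
move=> e0 H1 H2 g1 g2.
have [tP] := simple_integral_sub_le H1 H2.
set t := fun x => _ in tP *; move/le_trans; apply.
(* The cut integrand, as a function of the pair of values of the two simple functions. *)
pose h (p : B * B) := Num.max (rnorm (p.1 - p.2) - e) 0.
have hle : (\int[mu]_(x in D) (h (t x))%:E <= del%:E)%E.
  apply: le_trans g2; apply: le_integral_nonmeasurable => x Dx.
    by rewrite lee_fin le_max lexx orbT.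
  rewrite lee_fin ge_max rnorm_ge0 andbT lerBlDr /= [_ + e]addrC.
  apply: le_trans (rnorm_sub_le _ (g x) _) _; rewrite lerD2r rnorm_distC; exact: g1.
rewrite (integral_of_tag tP) in hle; last by move=> p; rewrite le_max lexx orbT.
rewrite lee_fin in hle; rewrite (mass_fibres tP) /= mulr_sumr.
apply: le_trans (lerD hle (lexx _)); rewrite -big_split /=; apply: ler_sum => p _.
rewrite [e * _]mulrC -mulrDr ler_wpM2l //; first exact: fibre_mass_ge0.
by rewrite -lerBlDr le_max lexx.
Qed.

Lemma simple_integral_dist (s1 s2 : X -> B) (e : R) : 
  is_simple mu D s1 -> is_simple mu D s2 ->
  (forall x, D x -> rnorm (s1 x - s2 x) <= e) ->
  rnorm (simple_integral mu D s1 - simple_integral mu D s2) <= e * fine (mu D).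
Proof.
move=> H1 H2 He.
have [tP] := simple_integral_sub_le H1 H2.
set t := fun x => _ in tP *; move/le_trans; apply.
rewrite (mass_fibres tP) /= mulr_sumr big_seq [leRHS]big_seq.
apply: ler_sum => p; rewrite (mem_tags tP) inE => -[x Dx <-].
by rewrite mulrC ler_wpM2r ?He //; exact: fibre_mass_ge0.
Qed.

Lemma cvg_rnormP (u : nat -> B) (l : B) :
  (u n @[n --> \oo] --> l) <->
  (forall e : R, 0 < e -> \forall n \near \oo, rnorm (l - u n) <= e).
Proof.
split=> [/cvgrPdist_le H e e0|H].
  have e0' : 0 < e%:C by rewrite ltcR.
  by apply: filterS (H _ e0') => n; rewrite rnormE lecR.
apply/cvgrPdist_le => e e0.
have eE : e = (complex.Re e)%:C by rewrite RRe_real // gtr0_real.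
have e0' : 0 < complex.Re e by rewrite -ltcR -eE.
by apply: filterS (H _ e0') => n; rewrite rnormE eE lecR.
Qed.

Lemma cauchy_rnorm_cvg (u : nat -> B) :
  (forall e : R, 0 < e -> exists N, forall n m, (N <= n)%N -> (N <= m)%N ->
     rnorm (u n - u m) <= e) ->
  cvgn u.
Proof.
move=> H; apply: cauchy_cvg; apply: cauchy_exP => e e0.
have eE : e = (complex.Re e)%:C by rewrite RRe_real // gtr0_real.
have e0' : 0 < complex.Re e by rewrite -ltcR -eE.
have [N HN] := H _ (divr_gt0 e0' (ltr0n _ 2)).
exists (u N); exists N => // n /= Nn.
rewrite /= -ball_normE /= rnormE eE ltcR.
by apply: le_lt_trans (HN _ _ _ Nn) _ => //; lra.
Qed.

Lemma ge0_cvge0 (u : nat -> \bar R) :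
  (forall e : R, 0 < e -> \forall n \near \oo, (0 <= u n <= e%:E)%E) ->
  u n @[n --> \oo] --> 0%E.
Proof.
move=> H Y /= [e /= e0 eY].
have e2 : 0 < e / 2 by rewrite divr_gt0.
suff : \forall n \near \oo, Y (u n) by [].
near=> n.
have : (0 <= u n <= (e / 2)%:E)%E by near: n; exact: H.
rewrite /=; case: (u n) => [r| |] //=; rewrite ?lee_fin => /andP[r0 re].
by apply: eY; rewrite /ball_ /= sub0r normrN ger0_norm //; lra.
Unshelve. all: by end_near.
Qed.

(** The integral of Bochner is independent of the approximating sequence, and uniform
    approximation on a set of finite measure is enough to compute it. *)
Theorem bochner_integral_uniform (g : X -> B) (s : nat -> X -> B) :
  (forall n, is_simple mu D (s n)) ->
  (forall e : R, 0 < e ->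
     \forall n \near \oo, forall x, D x -> rnorm (g x - s n x) <= e) ->
  simple_integral mu D (s n) @[n --> \oo] --> bochner_integral mu D g.
Proof.
move=> sP sg.
have m0 : 0 <= fine (mu D) by rewrite fine_ge0.
have esmall (del : R) : 0 < del -> exists e : R, [/\ 0 <= e, e <= del, e * fine (mu D) <= del &
    \forall n \near \oo, forall x, D x -> rnorm (g x - s n x) <= e].
  move=> del0; have m1 : 0 < fine (mu D) + 1 by lra.
  have d1 : 0 < del / (fine (mu D) + 1) by rewrite divr_gt0.
  have dE : del / (fine (mu D) + 1) * (fine (mu D) + 1) = del by rewrite divfK // gt_eqF.
  move: (del / _) d1 dE => e e0 eE; exists e.
  have em0 : 0 <= e * fine (mu D) by rewrite mulr_ge0 // ltW.
  rewrite mulrDr mulr1 in eE; rewrite -eE.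
  by split; [exact: ltW|rewrite lerDr|rewrite lerDl ltW|exact: sg].
have cvgS : cvgn (fun n => simple_integral mu D (s n)).
  apply: cauchy_rnorm_cvg => del del0.
  have [e [e0 _ em [N _ HN]]] := esmall _ (divr_gt0 del0 (ltr0n _ 2)).
  exists N => n m Nn Nm.
  apply: le_trans (simple_integral_dist (e := e + e) (sP n) (sP m) _) _.
    move=> x Dx; apply: le_trans (rnorm_sub_le _ (g x) _) _.
    by rewrite rnorm_distC lerD // HN.
  by rewrite mulrDl [leRHS]splitr lerD.
have [v vP] : exists v, is_bochner_integral mu D g v.
  exists (limn (fun n => simple_integral mu D (s n))), s; split=> //.
    apply: aeW => x Dx; apply/cvg_rnormP => del del0.
    by apply: filterS (sg _ del0) => n; apply.
  apply: ge0_cvge0 => del del0.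
  have [e [e0 _ em He]] := esmall _ del0; apply: filterS He => n He.
  rewrite integral_ge0 /=; last by move=> x _; rewrite lee_fin rnorm_ge0.
  apply: (@le_trans _ _ (\int[mu]_(x in D) (cst e%:E x))%E).
    by apply: le_integral_nonmeasurable => x Dx; rewrite lee_fin ?rnorm_ge0 ?He.
  by rewrite integral_cst // -[mu D]fineK ?finite_mass // -EFinM lee_fin.
have [s' [s'P _ s'g s'b]] : is_bochner_integral mu D g (bochner_integral mu D g).
  exact: xgetPex (ex_intro _ v vP).
apply/cvg_rnormP => del del0.
have d3 : 0 < del / 3 by rewrite divr_gt0.
have [e [e0 _ em He]] := esmall _ d3; apply: filterS He => n He.
have Ha : \forall m \near \oo,
    rnorm (bochner_integral mu D g - simple_integral mu D (s' m)) <= del / 3.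
  by move/cvg_rnormP: s'b; apply.
have Hb : \forall m \near \oo,
    (\int[mu]_(x in D) (rnorm (g x - s' m x))%:E <= (del / 3)%:E)%E.
  have del3 : (0 < (del / 3)%:E)%E by rewrite lte_fin.
  have Hc := s'g _ (open_ereal_lt' del3).
  by near do apply: ltW; exact: Hc.
have [m [Hm1 Hm2]] := filter_ex (filterI Ha Hb).
apply: le_trans (rnorm_sub_le _ (simple_integral mu D (s' m)) _) _.
have H := simple_integral_near e0 (sP n) (s'P m) He Hm2.
rewrite [X in _ + X]rnorm_distC; lra.
Unshelve. all: by end_near.
Qed.

End Tagged.

Section BochnerRiemann.
Variables (R : realType) (B : completeNormedModType R[i]).
Local Notation mu := (@lebesgue_measure R).
Variables (T : R) (g : R -> B).
Hypothesis T0 : 0 < T.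

Definition riemann_tag (n : nat) (t : R) : nat := Num.truncn (t * n%:R / T).

Definition riemann_sum (n : nat) : B :=
  \sum_(j < n) (T / n%:R)%:C *: g (j%:R * T / n%:R).

Section OneMesh.
Variable n : nat.
Hypothesis n0 : (0 < n)%N.

Let nr0 : 0 < (n%:R : R). Proof. by rewrite ltr0n. Qed.

Lemma riemann_tagP t : 0 <= t ->
  (riemann_tag n t)%:R * T / n%:R <= t < (riemann_tag n t).+1%:R * T / n%:R.
Proof.
move=> t0; have := @truncn_itv R (t * n%:R / T).
rewrite -/(riemann_tag n t) => /(_ _)/andP[|h1 h2].
  by rewrite divr_ge0 ?mulr_ge0 // ltW.
rewrite ler_pdivrMr // ltr_pdivlMr //.
by rewrite ler_pdivlMr // in h1; rewrite ltr_pdivrMr // in h2; rewrite h1.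
Qed.

Lemma riemann_tag_image : riemann_tag n @` `[0, T] = `I_n.+1.
Proof.
apply/seteqP; split=> [_ [t /= + <-]|j /= jn].
  rewrite in_itv /= => /andP[t0 tT]; rewrite /riemann_tag ltnS.
  rewrite -ltnS truncn_lt_nat ?divr_ge0 ?mulr_ge0 ?(ltW T0) //.
  rewrite ltr_pdivrMr // -natr1.
  have H : t * n%:R <= T * n%:R by rewrite ler_wpM2r // ltW.
  by apply: le_lt_trans H _; rewrite mulrDl mul1r mulrC ltrDl.
exists (j%:R * T / n%:R).
  rewrite /= in_itv /= divr_ge0 ?mulr_ge0 ?(ltW T0) //=.
  by rewrite ler_pdivrMr // mulrC ler_wpM2l ?(ltW T0) // ler_nat.
rewrite /riemann_tag (_ : j%:R * T / n%:R * n%:R / T = j%:R) ?natrK //.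
by field; rewrite !gt_eqF.
Qed.

Lemma riemann_fibre j : (j < n)%N ->
  `[0, T] `&` riemann_tag n @^-1` [set j] =
  [set` `[j%:R * T / n%:R, j.+1%:R * T / n%:R[%R].
Proof.
move=> jn; apply/seteqP; split=> [t [/=] |t /=].
  by rewrite !in_itv /= => /andP[t0 _] <-; exact: riemann_tagP.
rewrite !in_itv /= => /andP[jt tj].
have j0 : 0 <= j%:R * T / n%:R by rewrite divr_ge0 ?mulr_ge0 // ltW.
have t0 := le_trans j0 jt.
split.
  rewrite t0 /=; apply: le_trans (ltW tj) _; rewrite ler_pdivrMr // mulrC.
  by rewrite ler_wpM2l ?ler_nat // ltW.
apply: truncn_def; rewrite ler_pdivlMr // ltr_pdivrMr //.
by rewrite -ler_pdivrMr // jt -ltr_pdivlMr.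
Qed.

Lemma riemann_fibre_last :
  `[0, T] `&` riemann_tag n @^-1` [set n] = [set T].
Proof.
apply/seteqP; split=> [t [/=] |t ->].
  rewrite !in_itv /= => /andP[t0 tT] tn.
  have /andP[] := riemann_tagP t0; rewrite tn.
  rewrite mulrC mulKf ?gt_eqF // => Tt _; apply/eqP; rewrite eq_le tT; lra.
split; first by rewrite /= in_itv /= ltW /=.
by rewrite /= /riemann_tag mulrC mulKf ?gt_eqF // natrK.
Qed.

Lemma riemann_mass j : (j < n)%N -> fibre_mass mu `[0, T] (riemann_tag n) j = T / n%:R.
Proof.
move=> jn; rewrite /fibre_mass riemann_fibre //= lebesgue_measure_itv /= lte_fin.
have E : j.+1%:R * T / n%:R = j%:R * T / n%:R + T / n%:R by rewrite -natr1; ring.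
have q0 : 0 < T / n%:R by rewrite divr_gt0.
by rewrite E ltrDl q0 /= addrAC subrr add0r.
Qed.

Lemma riemann_mass_last : fibre_mass mu `[0, T] (riemann_tag n) n = 0.
Proof. by rewrite /fibre_mass riemann_fibre_last /= lebesgue_measure_set1. Qed.

Lemma riemann_finite_tag : finite_tag `[0, T] (riemann_tag n).
Proof.
split; first by rewrite riemann_tag_image; exact: finite_II.
move=> j; case: (ltngtP j n) => [jn|nj|->]; first by rewrite riemann_fibre.
  rewrite (_ : _ `&` _ = set0) //; apply/seteqP; split=> // t [t0T /= tj].
  have : (riemann_tag n @` `[0, T]) j by exists t.
  by rewrite riemann_tag_image /= ltnNge nj.
by rewrite riemann_fibre_last.
Qed.

Lemma riemann_simple :
  let s := fun t => g ((riemann_tag n t)%:R * T / n%:R) in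
  is_simple mu `[0, T] s /\ simple_integral mu `[0, T] s = riemann_sum n.
Proof.
move=> s; have muT : (mu `[0%R, T]%classic < +oo)%E.
  by rewrite lebesgue_measure_itv /=; case: ifP => _; rewrite -?EFinB ltry.
have mT : measurable (`[0, T] : set R) by [].
have [sS ->] := simple_of_tag (mu := mu) mT muT riemann_finite_tag
  (c := fun j => g (j%:R * T / n%:R)) (fun t _ => erefl (s t)).
split=> //; rewrite riemann_tag_image.
rewrite -fsbig_finite; last exact: finite_II.
rewrite -(fsbig_ord _ n.+1 (fun j => (fibre_mass mu `[0, T] (riemann_tag n) j)%:C
   *: g (j%:R * T / n%:R))) big_ord_recr /= riemann_mass_last scale0r addr0.
by apply: eq_bigr => j _; rewrite riemann_mass.
Qed.

End OneMesh.

Hypothesis gU : forall e : R, 0 < e -> exists2 del : R, 0 < del &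
  forall s t, 0 <= s -> 0 <= t -> `|s - t| <= del -> rnorm (g s - g t) <= e.

Lemma cvg_riemann_sum :
  riemann_sum n.+1 @[n --> \oo] --> bochner_integral mu `[0, T] g.
Proof.
have muT : (mu `[0%R, T]%classic < +oo)%E.
  by rewrite lebesgue_measure_itv /=; case: ifP => _; rewrite -?EFinB ltry.
have mT : measurable (`[0, T] : set R) by [].
pose s n t := g ((riemann_tag n.+1 t)%:R * T / n.+1%:R).
rewrite (_ : (fun n => _) = (fun n => simple_integral mu `[0, T] (s n))); last first.
  by apply: funext => n; have [_ ->] := riemann_simple (ltn0Sn n).
apply: (bochner_integral_uniform (mu := mu) mT muT) => [n|e e0].
  by have [] := riemann_simple (ltn0Sn n).
have [del d0 Hdel] := gU e0.
near=> n => t; rewrite /= in_itv /= => /andP[t0 tT]; apply: Hdel => //.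
  by rewrite divr_ge0 ?mulr_ge0 // ltW.
have /andP[h1 h2] := riemann_tagP (ltn0Sn n) t0.
rewrite ger0_norm ?subr_ge0 //.
have : T / n.+1%:R <= del.
  rewrite ler_pdivrMr // mulrC -ler_pdivrMr //.
  apply: le_trans (ltW (archi_boundP (divr_ge0 (ltW T0) (ltW d0)))) _.
  rewrite ler_nat; apply: leqW; near: n; exact: nbhs_infty_ge.
move=> Tdel; rewrite lerBlDl; apply: le_trans (ltW h2) _.
by rewrite -[(riemann_tag _ t).+1%:R]natr1 mulrDl mulrDl mul1r lerD2l.
Unshelve. all: by end_near.
Qed.

End BochnerRiemann.
(** * Choice of the number of summations by parts *)

Section Optimize.
Variable R : realType.
Local Notation beta := (4^-1 : R).

(** With [r = p^(1/4)] and [m] of order [r], [m^3 / p] is of order [1 / r]: the Gevrey bound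
    becomes [e^(- m)] with room to absorb every constant. *)
Definition parts_number (p : R) : nat := (Num.truncn (p `^ beta)).+1.

Lemma parts_number_bound : exists2 P : R, 1 <= P & forall p, P <= p ->
  (parts_number p)%:R <= p /\
  (80 * (parts_number p)%:R ^+ 3 / p) ^+ parts_number p <= expR (- (p `^ beta)).
Proof.
have e1 : 1 <= expR 1 :> R by rewrite -expR0 ler_expR.
pose r0 : R := 640 * expR 1.
have r01 : 640 <= r0 by rewrite /r0; lra.
have P1 : 1 <= r0 ^+ 4 by rewrite exprn_ege1 //; lra.
exists (r0 ^+ 4) => // p Pp.
have p1 : 1 <= p by apply: le_trans Pp.
have p0 : 0 <= p by lra.
pose r := p `^ beta.
have rp : r ^+ 4 = p by rewrite /r -powR_mulrn ?powR_ge0 // -powRrM mulVf ?powRr1.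
have r_ge0 : 0 <= r by exact: powR_ge0.
have rr0 : r0 <= r.
  by rewrite -(@ler_pXn2r _ 4) ?nnegrE ?rp //; lra.
have /andP[m1 m2] := truncn_itv r_ge0.
rewrite -/r /parts_number; set m := (Num.truncn r).+1.
have rm : r <= m%:R by exact: ltW.
have mr : m%:R <= 2 * r by rewrite /m -natr1; lra.
have r1 : 1 <= r by lra.
have r2 : 2 * r <= r ^+ 2 by rewrite expr2 ler_wpM2r //; lra.
split.
  rewrite -rp; apply: le_trans mr (le_trans r2 _).
  by rewrite ler_weXn2l.
have q0 : 0 <= 80 * m%:R ^+ 3 / p by rewrite divr_ge0 // mulr_ge0 // exprn_ge0.
have qe : 80 * m%:R ^+ 3 / p <= expR (-1).
  rewrite expRN ler_pdivrMr; last lra.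
  apply: (@le_trans _ _ (80 * (2 * r) ^+ 3)).
    by rewrite ler_wpM2l // lerXn2r ?nnegrE // mulr_ge0.
  rewrite -ler_pdivrMl ?invr_gt0 ?expR_gt0 // invrK -rp.
  have -> : expR 1 * (80 * (2 * r) ^+ 3) = r0 * r ^+ 3 by rewrite /r0; ring.
  by rewrite [r ^+ 4]exprS ler_wpM2r // exprn_ge0.
apply: (@le_trans _ _ (expR (-1) ^+ m)); first by rewrite lerXn2r ?nnegrE ?expR_ge0.
by rewrite -expRM_natl ler_expR mulrN1 lerN2.
Qed.

Lemma mul20_pi_le80 : 20 * pi <= 80 :> R.
Proof. by have := pihalf_lt2 R; lra. Qed.

End Optimize.

(** * Convergence of the weighted averages *)

Section Averages.
Variables (R : realType) (B : completeNormedModType R[i]).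
Variables (mu : probability (torus R) R) (eta : nat) (phi d Delta : R -> R).
Variables (gamma c : R) (f : torus R -> B).
Hypothesis eta_gt0 : (0 < eta)%N.
Hypothesis phi_adapt : adaptive_function phi.
Hypothesis d_approx : approximation_function d.
Hypothesis Delta_approx : approximation_function Delta.
Hypothesis gamma_gt0 : 0 < gamma.
Hypothesis c_gt0 : 0 < c.
Hypothesis fB : in_BDelta mu eta Delta f.
Hypothesis trunc : truncation_condition eta phi d Delta gamma c.

Local Notation norm := (eta_norm R eta).
Local Notation mean := (bochner_integral mu setT f).
Local Notation beta := (4^-1 : R).
Local Notation decay x := (expR (- (phi x `^ beta))).
Local Notation cutoff := (cutoff phi d gamma).

(** [d] maps [1, +oo[ onto [d 1, +oo[ by the intermediate value theorem, so [approx_inv d]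
    is a genuine inverse at [y]. *)
Lemma approx_inv_le (y r : R) : d 1 <= y -> 1 <= r -> r <= approx_inv d y -> d r <= y.
Proof.
have [cd incd _ dy] := d_approx; move=> y1 r1 ry.
have yim : y \in d @` `[1, +oo[.
  have [a [a1 ay]] : exists a, 1 <= a /\ y <= d a.
    have H1 : \forall a \near (+oo : set_system R), 1 <= a by exact: nbhs_pinfty_ge (num_real _).
    have H2 : \forall a \near (+oo : set_system R), y <= d a by move/cvgryPge: dy; apply.
    exact: filter_ex (filterI H1 H2).
  have ca : {within `[1, a], continuous d}.
    apply: continuous_subspaceW cd => t /=; rewrite !in_itv /= => /andP[-> _] //.
  have [|b] := IVT a1 ca (v := y); first by rewrite ge_min y1 le_max ay orbT.
  by rewrite in_itv /= => /andP[b1 _] <-; rewrite inE; exists b; rewrite //= in_itv /= b1.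
have zy : d (approx_inv d y) = y by rewrite /approx_inv pinvK.
rewrite -zy; case: (ltgtP r (approx_inv d y)) ry => // [ry _|-> //].
by apply/ltW/incd; rewrite // in_itv /= ?r1 // (le_trans r1) // ltW.
Qed.

Lemma phi_near (P : R) : \forall x \near +oo, P <= phi x.
Proof. by have [_ + _] := phi_adapt; move/cvgryPge; apply. Qed.

Lemma phi_sublinear (e : R) : 0 < e -> \forall x \near +oo, `|phi x| <= e * x.
Proof.
move=> e0; have [_ _ /cvgrPdist_le /(_ _ e0) H] := phi_adapt.
have H1 : \forall x \near +oo, (1 : R) <= x by exact: nbhs_pinfty_ge (num_real _).
apply: filterS2 H H1 => x Hx x1.
move: Hx; rewrite sub0r normrN normrM normfV (ger0_norm (x := x)); last lra.
by rewrite ler_pdivrMr //; lra.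
Qed.

(** [x / phi x] tends to infinity, so the cutoff is eventually taken in the range of [d]. *)
Lemma low_frequency : \forall x \near +oo, forall k, Zstar R eta k -> k != 0 ->
  norm k <= cutoff x -> phi x / (2 * pi * x) <= gamma / d (norm k).
Proof.
have [_ _ d1 _] := d_approx.
have d11 := d1 1 (lexx _).
have G0 : 0 < 2 * pi * gamma by rewrite !mulr_gt0 ?pi_gt0.
have e0 : 0 < 2 * pi * gamma / d 1 by rewrite divr_gt0 //; lra.
have H1 : \forall x \near +oo, (1 : R) <= x by exact: nbhs_pinfty_ge (num_real _).
near=> x => k kZ k0 kx.
have x1 : 1 <= x by near: x.
have p1 : 1 <= phi x by near: x; exact: phi_near.
have p0 : 0 < phi x by lra.
have px : `|phi x| <= 2 * pi * gamma / d 1 * x by near: x; exact: phi_sublinear.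
rewrite (gtr0_norm p0) mulrAC ler_pdivlMr in px; last lra.
have k1 := eta_norm_ge1 kZ k0.
have : d (norm k) <= 2 * pi * gamma * x / phi x.
  by apply: approx_inv_le => //; rewrite ler_pdivlMr // mulrC.
have dk := d1 _ k1.
have pi0 := pi_gt0 R.
rewrite ler_pdivlMr // => H.
rewrite ler_pdivrMr; last by rewrite !mulr_gt0 //; lra.
rewrite mulrAC ler_pdivlMr; last lra.
by rewrite mulrC; apply: le_trans H _; rewrite le_eqVlt; apply/orP; left; apply/eqP; ring.
Unshelve. all: by end_near.
Qed.

(** The low frequencies times [v] stay at a distance of order [phi x / N] from the
    integers in two situations: averages over [N] iterates, with [x = N], and Riemann sums
    with [N] points for a flow over the time [x], with [N] tending to infinity. *)
Lemma weighted_average_le : exists2 K : R, 0 <= K &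
  \forall x \near +oo, forall (N : nat) (v : nat -> R) (theta : torus R),
    phi x <= N%:R ->
    (forall k, Zstar R eta k -> k != 0 -> norm k <= cutoff x ->
       forall n : int, phi x / (2 * pi * N%:R) <= `|dot k v - n%:~R|) ->
    rnorm (\sum_(n < N) (bump_fun (n%:R / N%:R : R))%:C *:
             f (translate (fun j => n%:R * v j) theta)
           - (\sum_(n < N) bump_fun (n%:R / N%:R))%:C *: mean)
    <= N%:R * (K * decay x).
Proof.
have [S [C [S0 C0 HF]]] :=
  fourier_multiplier_sum_le eta_gt0 d_approx Delta_approx fB trunc.
have [P P1 HP] := parts_number_bound R.
exists (2 * S + C); first by rewrite addr_ge0 // mulr_ge0.
near=> x => N v theta pN Hv.
have pP : P <= phi x by near: x; exact: phi_near.
have p1 : 1 <= phi x by exact: le_trans pP.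
have p0 : 0 < phi x by exact: lt_le_trans p1.
have N0 : 0 < (N%:R : R) by exact: lt_le_trans pN.
have N0' : (0 < N)%N by rewrite -(ltr_nat R).
have pi0 := pi_gt0 R.
have px : expR (- (c * x)) <= decay x.
  rewrite ler_expR lerN2; apply: (@le_trans _ _ (phi x)).
    by apply: ler1_powR => //; rewrite invf_le1 // ler1n.
  by apply: le_trans (ler_norm _) _; near: x; exact: phi_sublinear.
pose z k := normc (multiplier N (fun n => bump_fun (n%:R / N%:R : R)) (fun n j => n%:R * v j) k).
have zW k : 0 <= z k <= N%:R.
  rewrite normc_ge0 /=; apply: le_trans (multiplier_le _ _ _ _) _.
  rewrite -[leRHS]mulr1 mulr_natl -[X in _ *+ X]card_ord -sumr_const.
  by apply: ler_sum => n _; rewrite ger0_norm ?bump_ge0 ?bump_le1.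
have zE k : Zstar R eta k -> k != 0 -> norm k <= cutoff x -> z k <= 2 * N%:R * decay x.
  move=> kZ k0 kx.
  have d0 : 0 < phi x / (2 * pi * N%:R) by rewrite divr_gt0 // !mulr_gt0.
  have -> : z k = normc (\sum_(n < N) (bump_fun (n%:R / N%:R))%:C
      * cis (2 * pi * dot k v) ^+ n).
    congr normc; apply: eq_bigr => n _.
    by rewrite (dotZ eta_gt0 _ _ kZ) -cis_natM; congr (_ * cis _); ring.
  have [mp me] := HP _ pP; set m := parts_number _ in mp me.
  apply: le_trans (bump_expsum_le m N0' d0 (Hv k kZ k0 kx)) _.
  have m3 : 0 <= (m%:R : R) ^+ 3 by rewrite exprn_ge0.
  have q1 : 0 <= 10 * m%:R ^+ 3 / (N%:R * (phi x / (2 * pi * N%:R))).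
    by rewrite divr_ge0 // mulr_ge0 // ltW.
  have q2 : 0 <= 80 * m%:R ^+ 3 / phi x by rewrite divr_ge0 ?mulr_ge0 // ltW.
  have NN : (N + m)%:R <= 2 * N%:R :> R.
    by rewrite natrD mulrDl mul1r lerD2l; exact: le_trans pN.
  apply: ler_pM => //.
    by rewrite exprn_ge0.
  apply: le_trans me; rewrite lerXn2r ?nnegrE //.
  rewrite (_ : N%:R * _ = phi x / (2 * pi)); last first.
    by move: (pi : R) pi0 => q q0; field; rewrite ?(gt_eqF N0) ?(gt_eqF q0).
  have -> : 10 * m%:R ^+ 3 / (phi x / (2 * pi)) = (20 * pi) * m%:R ^+ 3 / phi x.
    by move: (pi : R) pi0 => q q0; field; rewrite ?(gt_eqF p0) ?(gt_eqF q0).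
  rewrite ler_wpM2r ?invr_ge0 ?(ltW p0) // ler_wpM2r //.
  exact: mul20_pi_le80.
have avg := translate_average_le eta_gt0 fB (N := N) (w := fun n => bump_fun (n%:R / N%:R : R))
  (v := fun n j => n%:R * v j) theta
  (C := S * (2 * N%:R * decay x) + N%:R * (C * expR (- (c * x)))).
apply: (le_trans (avg _)).
  have HFx : forall (z : (nat -> int) -> R) (E W : R), 0 <= E -> 0 <= W ->
    (forall k, 0 <= z k <= W) ->
    (forall k, Zstar R eta k -> k != 0 -> norm k <= cutoff x -> z k <= E) ->
    forall F : {fset nat -> int}, (forall k, k \in F -> Zstar R eta k /\ k != 0) ->
    \sum_(k <- F) z k * rnorm (fourier_coef mu f k) <= S * E + W * (C * expR (- (c * x))).
    by near: x.
  by apply: HFx => //; rewrite ?mulr_ge0 ?expR_ge0 // ltW.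
have NC : N%:R * (C * expR (- (c * x))) <= N%:R * (C * decay x).
  by rewrite !ler_wpM2l // ltW.
apply: le_trans (lerD (lexx _) NC) _; rewrite le_eqVlt; apply/orP; left; apply/eqP; ring.
Unshelve. all: by end_near.
Qed.

Lemma sum_wbar N : \sum_(n < N) wbar (n%:R / N%:R : R) =
  (bump_integral R)^-1 * \sum_(n < N) bump_fun (n%:R / N%:R).
Proof. by rewrite mulr_sumr; apply: eq_bigr => n _; rewrite wbarE. Qed.

(** The normalization of the weight cancels. *)
Lemma WB_discreteE (rho : nat -> R) (N : nat) (theta : torus R) :
  let A := \sum_(n < N) bump_fun (n%:R / N%:R : R) in
  WB_discrete rho f N theta = (A^-1)%:C *: \sum_(n < N) (bump_fun (n%:R / N%:R : R))%:C *:
    f (translate (fun j => n%:R * rho j) theta).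
Proof.
move=> A; have I0 := bump_integral_gt0 R.
rewrite /WB_discrete !big_mkord sum_wbar invfM invrK -/A rmorphM /= mulrC -scalerA.
congr (_ *: _); rewrite scaler_sumr; apply: eq_bigr => n _.
rewrite scalerA wbarE -rmorphM /= mulrA divff ?mul1r ?gt_eqF //.
by rewrite iter_translate.
Qed.

(** The normalizing sum is at least [N I / 2], [I] being the integral of the bump function. *)
Lemma discrete_average_le : exists2 K : R, 0 <= K & forall rho : nat -> R,
  nonresonant_discrete eta gamma d rho ->
  \forall N \near \oo, forall theta : torus R,
    rnorm (WB_discrete rho f N theta - mean) <= K * decay N%:R.
Proof.
have [K K0 HK] := weighted_average_le; have I0 := bump_integral_gt0 R.
exists (2 / bump_integral R * K); first by rewrite mulr_ge0 // divr_ge0 // ltW.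
move=> rho rhoP.
have HxN : \forall x \near +oo, forall N : nat, x = N%:R -> forall theta : torus R,
    rnorm (WB_discrete rho f N theta - mean) <= 2 / bump_integral R * K * decay x.
  near=> x => N xN theta.
  have x1 : 40 / bump_integral R <= x by near: x; exact: nbhs_pinfty_ge (num_real _).
  have p1 : 1 <= phi x by near: x; exact: phi_near.
  have px : `|phi x| <= 1 * x by near: x; exact: phi_sublinear.
  have low : forall k, Zstar R eta k -> k != 0 -> norm k <= cutoff x ->
    phi x / (2 * pi * x) <= gamma / d (norm k) by near: x; exact: low_frequency.
  have H : forall (N : nat) (v : nat -> R) (theta : torus R),
    phi x <= N%:R ->
    (forall k, Zstar R eta k -> k != 0 -> norm k <= cutoff x ->
       forall n : int, phi x / (2 * pi * N%:R) <= `|dot k v - n%:~R|) ->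
    rnorm (\sum_(n < N) (bump_fun (n%:R / N%:R : R))%:C *:
             f (translate (fun j => n%:R * v j) theta)
           - (\sum_(n < N) bump_fun (n%:R / N%:R))%:C *: mean)
    <= N%:R * (K * decay x) by near: x.
  have pN : phi x <= N%:R.
    by rewrite -xN; apply: le_trans (ler_norm _) _; rewrite mul1r in px.
  have N0 : 0 < (N%:R : R) by lra.
  have {}H := H N rho theta pN _.
  rewrite WB_discreteE; set A := \sum_(n < N) bump_fun _ in H *.
  have NA : N%:R * bump_integral R / 2 <= A.
    have := @bump_riemann R N; rewrite -/A -(ltr_nat R) => /(_ N0).
    rewrite ler_norml => /andP[+ _].
    rewrite xN ler_pdivrMr // in x1; lra.
  have A0 : 0 < A by apply: lt_le_trans NA; rewrite divr_gt0 // mulr_gt0.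
  set s := \sum_(n < N) _ *: _ in H *.
  have -> : (A^-1)%:C *: s - mean = (A^-1)%:C *: (s - A%:C *: mean).
    by rewrite scalerBr scalerA -rmorphM /= mulVf ?gt_eqF // scale1r.
  rewrite rnormZ normc_real ger0_norm ?invr_ge0 ?(ltW A0) //.
  rewrite ler_pdivrMl //.
  have {}H : rnorm (s - A%:C *: mean) <= N%:R * (K * decay x).
    apply: H => k kZ k0 kx n; rewrite -xN; apply: le_trans (low k kZ k0 kx) _.
    by apply: ltW; exact: rhoP.
  apply: le_trans H _.
  have Kd : 0 <= K * decay x by rewrite mulr_ge0 ?expR_ge0.
  have -> : A * (2 / bump_integral R * K * decay x) =
    (A * (2 / bump_integral R)) * (K * decay x) by ring.
  rewrite ler_wpM2r // mulrA ler_pdivlMr // -ler_pdivrMr //.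
have HN : \forall M \near \oo, forall N : nat, M%:R = N%:R :> R -> forall theta : torus R,
    rnorm (WB_discrete rho f N theta - mean) <= 2 / bump_integral R * K * decay M%:R.
  exact: (cvgr_idn HxN).
by apply: filterS HN => N HN theta; exact: HN.
Unshelve. all: by end_near.
Qed.

(** The observable along the flow, with its weight, is a uniform limit of trigonometric
    polynomials in time, hence uniformly continuous. *)
Lemma weighted_flow_uniform (rho : nat -> R) (T : R) (theta : torus R) : 0 < T ->
  let g := fun t => (wbar (t / T))%:C *: f (translate (fun j => rho j * t) theta) in
  forall e : R, 0 < e -> exists2 del : R, 0 < del &
  forall s t, 0 <= s -> 0 <= t -> `|s - t| <= del -> rnorm (g s - g t) <= e.
Proof.
move=> T0 g e e0; have I0 := bump_integral_gt0 R; have pi0 := pi_gt0 R.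
have [S [C [S0 C0 HF]]] :=
  fourier_multiplier_sum_le eta_gt0 d_approx Delta_approx fB trunc.
set J := (bump_integral R)^-1; have J0 : 0 < J by rewrite invr_gt0.
have wb x : 0 <= wbar x <= J.
  rewrite wbarE mulr_ge0 ?bump_ge0 ?(ltW J0) //=.
  by rewrite -[leRHS]mulr1 ler_wpM2l ?(ltW J0) // bump_le1.
have wl x y : `|wbar x - wbar y| <= J * 20 * `|x - y|.
  rewrite !wbarE -mulrBr normrM (gtr0_norm J0) -mulrA ler_wpM2l ?(ltW J0) //.
  exact: bump_lipschitz.
have tail : \forall x \near +oo, 2 * J * (C * expR (- (c * x))) <= e / 2.
  have A0 : 0 <= 2 * J * C by rewrite !mulr_ge0 // ltW.
  have H1 : \forall x \near +oo, 2 * J * C / (e / 2 * c) <= x by exact: nbhs_pinfty_ge (num_real _).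
  apply: filterS H1 => x; rewrite ler_pdivrMr ?mulr_gt0 ?divr_gt0 // => H1.
  rewrite mulrA expRN ler_pdivrMr ?expR_gt0 //.
  apply: (@le_trans _ _ (e / 2 * (1 + c * x))); first by lra.
  by rewrite ler_wpM2l ?divr_ge0 ?(ltW e0) // expR_ge1Dx.
have [x [HFx Hx]] := filter_ex (filterI HF tail).
have [D D0 HD] := finite_set_bounded (fun k => dot (R := R) k rho)
  (finite_Zstar_le (R := R) eta_gt0 (cutoff x)).
(* Lipschitz constant in time of the multiplier at frequencies below the cutoff. *)
pose L := J * 20 / T + J * (2 * (2 * pi * D)).
have L0 : 0 <= L by rewrite addr_ge0 ?divr_ge0 ?mulr_ge0 ?(ltW J0) ?(ltW T0) ?(ltW pi0).
pose M := S * L + J * 20 / T * rnorm mean.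
have JT0 : 0 <= J * 20 / T by rewrite divr_ge0 ?mulr_ge0 ?(ltW J0) ?(ltW T0).
have M0 : 0 <= M by rewrite addr_ge0 // mulr_ge0 // rnorm_ge0.
exists (e / 2 / (M + 1)); first by rewrite !divr_gt0 //; lra.
move=> s t s0 t0 st.
have Mst : M * `|s - t| <= e / 2.
  rewrite ler_pdivlMr in st; last lra.
  by apply: le_trans st; rewrite mulrC ler_wpM2l // lerDl.
pose w (n : nat) := if n == 0%N then wbar (s / T) else - wbar (t / T).
pose v (n : nat) (j : nat) := if n == 0%N then rho j * s else rho j * t.
have wst : `|wbar (s / T) - wbar (t / T)| <= J * 20 / T * `|s - t|.
  apply: le_trans (wl _ _) _; rewrite -mulrBl normrM (gtr0_norm (x := T^-1)) ?invr_gt0 //.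
  by rewrite le_eqVlt; apply/orP; left; apply/eqP; ring.
have zW k : 0 <= normc (multiplier 2 w v k) <= 2 * J.
  rewrite normc_ge0 /=; apply: le_trans (multiplier_le _ _ _ _) _.
  rewrite !big_ord_recl big_ord0 /= addr0 normrN.
  have /andP[w1 w2] := wb (s / T); have /andP[w3 w4] := wb (t / T).
  by rewrite !ger0_norm // mulr_natl mulr2n lerD.
have zE k : Zstar R eta k -> k != 0 -> norm k <= cutoff x ->
    normc (multiplier 2 w v k) <= L * `|s - t|.
  move=> kZ k0 kx.
  have -> : multiplier 2 w v k = (wbar (s / T))%:C * cis (2 * pi * dot k (fun j => rho j * s))
      + (- wbar (t / T))%:C * cis (2 * pi * dot k (fun j => rho j * t)).
    by rewrite /multiplier !big_ord_recl big_ord0 addr0.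
  have E u : dot k (fun j => rho j * u) = u * dot k rho.
    by rewrite -(dotZ eta_gt0 _ _ kZ); congr dot; apply: funext => j; rewrite mulrC.
  rewrite !E; set a := wbar (s / T); set b := wbar (t / T); set q := dot k rho.
  have -> : a%:C * cis (2 * pi * (s * q)) + (- b)%:C * cis (2 * pi * (t * q)) =
     (a - b)%:C * cis (2 * pi * (s * q)) + b%:C * (cis (2 * pi * (s * q)) - cis (2 * pi * (t * q))).
    by rewrite !rmorphB rmorphN /=; ring.
  apply: le_trans (le_normcD _ _) _; rewrite !normcM normc_cis mulr1 !normc_real /L [leRHS]mulrDl.
  apply: lerD => //.
  have /andP[b0 bJ] := wb (t / T); rewrite -/b in b0 bJ.
  rewrite (ger0_norm b0) -[leRHS]mulrA; apply: ler_pM => //; first exact: normc_ge0.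
  apply: le_trans (cis_lipschitz _ _) _; rewrite -[leRHS]mulrA ler_wpM2l //.
  have -> : 2 * pi * (s * q) - 2 * pi * (t * q) = 2 * pi * (q * (s - t)) by ring.
  rewrite normrM (gtr0_norm (x := 2 * pi)) ?mulr_gt0 // -[leRHS]mulrA ler_wpM2l //.
    by rewrite mulr_ge0 // ltW.
  by rewrite normrM ler_wpM2r // HD.
have Ls0 : 0 <= L * `|s - t| by rewrite mulr_ge0.
have J20 : 0 <= 2 * J by rewrite mulr_ge0 // ltW.
have avg := translate_average_le eta_gt0 fB theta (HFx _ _ _ Ls0 J20 zW zE).
rewrite !big_ord_recl !big_ord0 /= !addr0 /w /v /= in avg.
have -> : g s - g t = ((wbar (s / T))%:C *: f (translate (fun j => rho j * s) theta)
   + (- wbar (t / T))%:C *: f (translate (fun j => rho j * t) theta)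
   - (wbar (s / T) - wbar (t / T))%:C *: mean) + (wbar (s / T) - wbar (t / T))%:C *: mean.
  by rewrite subrK rmorphN scaleNr.
apply: le_trans (rnormD _ _) _; apply: le_trans (lerD avg (lexx _)) _.
rewrite rnormZ normc_real.
have HW : `|wbar (s / T) - wbar (t / T)| * rnorm mean <= J * 20 / T * `|s - t| * rnorm mean.
  by rewrite ler_wpM2r ?rnorm_ge0.
apply: le_trans (lerD (lerD (lexx _) Hx) HW) _.
have -> : S * (L * `|s - t|) + e / 2 + J * 20 / T * `|s - t| * rnorm mean = M * `|s - t| + e / 2.
  by rewrite /M; ring.
by rewrite [leRHS]splitr lerD2r.
Qed.

(** A Riemann sum of the time average is a weighted average for the rotation vector
    [(T / n) rho]. *)
Lemma WB_continuous_riemannE (rho : nat -> R) (T : R) (theta : torus R) (n : nat) : 0 < T ->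
  let g := fun t => (wbar (t / T))%:C *: f (translate (fun j => rho j * t) theta) in
  let v := fun j => rho j * (T / n%:R) in
  (T^-1)%:C *: riemann_sum T g n = ((n%:R * bump_integral R)^-1)%:C *:
    \sum_(j < n) (bump_fun (j%:R / n%:R : R))%:C *: f (translate (fun i => j%:R * v i) theta).
Proof.
move=> T0 g v; rewrite /riemann_sum !scaler_sumr; apply: eq_bigr => j _.
rewrite /g !scalerA; congr (_ *: f (translate _ _)); last first.
  by apply: funext => i; rewrite /v; ring.
rewrite wbarE -!rmorphM /= invfM; congr (_%:C).
have -> : j%:R * T / n%:R / T = j%:R / n%:R.
  by rewrite mulrAC mulfK // gt_eqF.
by rewrite !mulrA mulVf ?gt_eqF // mul1r; ring.
Qed.

(** Up to an arbitrary [e], the time average is a Riemann sum whose mesh is taken so fine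
    that: the sum is close to the integral, the weights sum nearly to one, and the low
    frequencies of the rotation do not wrap around the circle. *)
Lemma continuous_average_le : exists2 K : R, 0 <= K & forall rho : nat -> R,
  nonresonant_continuous eta gamma d rho ->
  \forall T \near +oo, forall theta : torus R,
    rnorm (WB_continuous rho f T theta - mean) <= K * decay T.
Proof.
have [K K0 HK] := weighted_average_le; have I0 := bump_integral_gt0 R.
exists (K / bump_integral R); first by rewrite divr_ge0 // ltW.
move=> rho rhoP; near=> T => theta.
have T1 : 1 <= T by near: T; exact: nbhs_pinfty_ge (num_real _).
have T0 : 0 < T by exact: lt_le_trans T1.
have p1 : 1 <= phi T by near: T; exact: phi_near.
have p0 : 0 < phi T by exact: lt_le_trans p1.
have low : forall k, Zstar R eta k -> k != 0 -> norm k <= cutoff T ->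
  phi T / (2 * pi * T) <= gamma / d (norm k) by near: T; exact: low_frequency.
have avg : forall (N : nat) (v : nat -> R) (theta : torus R),
    phi T <= N%:R ->
    (forall k, Zstar R eta k -> k != 0 -> norm k <= cutoff T ->
       forall n : int, phi T / (2 * pi * N%:R) <= `|dot k v - n%:~R|) ->
    rnorm (\sum_(n < N) (bump_fun (n%:R / N%:R : R))%:C *:
             f (translate (fun j => n%:R * v j) theta)
           - (\sum_(n < N) bump_fun (n%:R / N%:R))%:C *: mean)
    <= N%:R * (K * decay T) by near: T.
pose g t := (wbar (t / T))%:C *: f (translate (fun j => rho j * t) theta).
have gU := @weighted_flow_uniform rho T theta T0.
have [D D0 HD] := finite_set_bounded (fun k => dot (R := R) k rho)
  (finite_Zstar_le (R := R) eta_gt0 (cutoff T)).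
apply/ler_addgt0Pr => e e0.
have e2 : 0 < e / 2 by rewrite divr_gt0.
have /cvg_rnormP/(_ _ (mulr_gt0 e2 T0)) R1 := cvg_riemann_sum T0 gU.
have /filter_ex[N [[RN pN] [DN mN]]] : \forall n \near \oo,
    (rnorm (bochner_integral (@lebesgue_measure R) `[0, T] g - riemann_sum T g n.+1) <= e / 2 * T
      /\ phi T <= n%:R)
    /\ (D * T * 2 <= n%:R /\ 20 / bump_integral R * rnorm mean / (e / 2) <= n%:R).
  apply: filterI; apply: filterI => //; apply: (cvgr_idn (nbhs_pinfty_ge (num_real _))).
set n := N.+1 in RN.
have Nn : N%:R <= n%:R :> R by rewrite ler_nat.
have n0 : 0 < (n%:R : R) by rewrite ltr0n.
have pi0 := pi_gt0 R.
pose v j := rho j * (T / n%:R).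
have Hv k : Zstar R eta k -> k != 0 -> norm k <= cutoff T ->
    forall z : int, phi T / (2 * pi * n%:R) <= `|dot k v - z%:~R|.
  move=> kZ k0 kT z.
  have vE : dot k v = dot k rho * (T / n%:R).
    rewrite [RHS]mulrC -(dotZ eta_gt0 _ _ kZ); congr dot.
    by apply: funext => j; rewrite /v mulrC.
  have q0 : 0 < T / n%:R by rewrite divr_gt0.
  have qlow : phi T / (2 * pi * n%:R) <= `|dot k v|.
    rewrite vE normrM (gtr0_norm q0) -ler_pdivrMr //.
    have -> : phi T / (2 * pi * n%:R) / (T / n%:R) = phi T / (2 * pi * T).
      by move: (pi : R) pi0 => q q1; field; rewrite ?(gt_eqF T0) ?(gt_eqF n0) ?(gt_eqF q1).
    by apply: le_trans (low k kZ k0 kT) _; apply: ltW; exact: rhoP.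
  have [->|z0] := eqVneq z 0; first by rewrite subr0.
  apply: le_trans qlow _.
  (* The frequency stays within 1/2 of zero, so zero is the nearest integer. *)
  have qhalf : `|dot k v| <= 2^-1.
    rewrite vE normrM (gtr0_norm q0) mulrA ler_pdivrMr //.
    apply: le_trans (ler_wpM2r (ltW T0) (HD k (conj kZ kT))) _.
    by rewrite ler_pdivlMl // mulrC; exact: le_trans DN Nn.
  have z1 : 1 <= `|z%:~R : R|.
    by rewrite -intr_norm -[1]/(1%:~R) ler_int -gtz0_ge1 normr_gt0.
  rewrite distrC; apply: le_trans (lerB_dist (z%:~R : R) (dot k v)).
  by rewrite lerBrDr; apply: le_trans z1; rewrite [1]splitr lerD // div1r.
have {}avg := avg n v theta (le_trans pN Nn) Hv.
rewrite /WB_continuous -/g; set G := bochner_integral _ _ _ in RN *.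
have sumE := WB_continuous_riemannE rho theta n T0.
set A := \sum_(j < n) bump_fun _ in avg; set s := \sum_(j < n) _ *: _ in avg.
pose q := (n%:R * bump_integral R)^-1; have q0 : 0 < q by rewrite invr_gt0 mulr_gt0.
have -> : (T^-1)%:C *: G - mean = (T^-1)%:C *: (G - riemann_sum T g n)
    + q%:C *: (s - A%:C *: mean) + (q * A - 1)%:C *: mean.
  rewrite !scalerBr scalerA -rmorphM sumE -/s -/q rmorphB scalerBl scale1r.
  by rewrite [X in _ = X + _]addrA subrK addrA subrK.
have E1 : rnorm ((T^-1)%:C *: (G - riemann_sum T g n)) <= e / 2.
  rewrite rnormZ normc_real (gtr0_norm (x := T^-1)) ?invr_gt0 // ler_pdivrMl // mulrC.
  exact: RN.
have E2 : rnorm (q%:C *: (s - A%:C *: mean)) <= K / bump_integral R * decay T.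
  rewrite rnormZ normc_real (gtr0_norm q0) ler_pdivrMl ?mulr_gt0 //.
  apply: le_trans avg _; rewrite le_eqVlt; apply/orP; left; apply/eqP.
  by field; rewrite gt_eqF.
have E3 : rnorm ((q * A - 1)%:C *: mean) <= e / 2.
  rewrite rnormZ normc_real.
  (* [q * A] is the sum of the normalized weights of the Riemann sum, close to 1. *)
  have -> : q * A - 1 = q * (A - n%:R * bump_integral R).
    by rewrite mulrBr [q * (_ * _)]mulVf // gt_eqF // mulr_gt0.
  rewrite normrM (gtr0_norm q0).
  have HA : `|A - n%:R * bump_integral R| <= 20 by exact: bump_riemann.
  apply: (@le_trans _ _ (q * 20 * rnorm mean)).
    by rewrite ler_wpM2r ?rnorm_ge0 // ler_wpM2l // ltW.
  rewrite -mulrA ler_pdivrMl ?mulr_gt0 //.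
  rewrite ler_pdivrMr // mulrAC ler_pdivrMr // in mN.
  apply: le_trans mN _; rewrite [leLHS]mulrAC ler_wpM2r ?(ltW e2) //.
  by rewrite ler_wpM2r // ltW.
apply: le_trans (rnormD _ _) _; apply: le_trans (lerD (rnormD _ _) (lexx _)) _.
apply: le_trans (lerD (lerD E1 E2) E3) _.
by rewrite addrAC -splitr addrC.
Unshelve. all: by end_near.
Qed.

End Averages.

(** * Stretched-exponential convergence *)

Unset Implicit Arguments.
Set Strict Implicit.
Set Printing Implicit Defensive.

Theorem theorem3p7 (R : realType) :
  exists beta : R, 0 < beta /\
  forall (B : completeNormedModType R[i]) (mu : probability (torus R) R)
    (eta : nat) (phi d Delta : R -> R) (gamma c : R) (f : torus R -> B),
  is_product_lebesgue mu ->
  (2 <= eta)%N ->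
  adaptive_function phi ->
  approximation_function d ->
  approximation_function Delta ->
  0 < gamma ->
  0 < c ->
  in_BDelta mu eta Delta f ->
  truncation_condition eta phi d Delta gamma c ->
  exists C6 : R, 0 < C6 /\
  forall rho : nat -> R, (forall j, 1 <= rho j <= 2) ->
    (nonresonant_discrete eta gamma d rho ->
     \forall N \near \oo, forall theta : torus R,
       rnorm (WB_discrete rho f N theta - bochner_integral mu setT f)
       <= C6 * expR (- (phi N%:R `^ beta)))
    /\
    (nonresonant_continuous eta gamma d rho ->
     \forall T \near +oo, forall theta : torus R,
       rnorm (WB_continuous rho f T theta - bochner_integral mu setT f)
       <= C6 * expR (- (phi T `^ beta))).
Proof.
exists 4^-1; split; first by rewrite invr_gt0.
move=> B mu eta phi d Delta gamma c f _ eta2 phiP dP DeltaP gamma0 c0 fB trunc.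
have eta0 : (0 < eta)%N by apply: leq_trans eta2.
have [K1 K10 H1] := discrete_average_le eta0 phiP dP DeltaP gamma0 c0 fB trunc.
have [K2 K20 H2] := continuous_average_le eta0 phiP dP DeltaP gamma0 c0 fB trunc.
exists (K1 + K2 + 1); split; first by lra.
move=> rho _; split=> [/H1|/H2]; apply: filterS => x Hx theta; apply: le_trans (Hx theta) _;
  by rewrite ler_wpM2r ?expR_ge0 //; lra.
Qed.
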